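(* Let $q$ be a prime power, let $f(x)=\sum_{j=1}^{d+2}u_j\prod_{i=1}^dx_i^{m_{ij}}$ with $u_j\in\mathbb{F}_q^\times$ be a Laurent polynomial with distinct exponent vectors, $d$-dimensional Newton polytope $\Delta$, and Gale dual $\gamma\in\mathbb{Z}^{d+2}$ having no zero component; let $r$ (respectively $s$) be the number of negative (respectively positive) components of $\gamma$. Let $Z\subset\mathbb{G}_m^d$ be the hypersurface $f=0$ over $\mathbb{F}_q$ and $\overline{Z}$ its closure in the toric variety $\mathbb{P}_\Delta$. Suppose that $q$ is coprime to $\gamma_1\cdots\gamma_{d+2}$, $r=1$ and $s=d+1$. Then $$\#\overline{Z}(\mathbb{F}_q)=\frac{q^d-1}{q-1}-\sum_{\lambda\in\Lambda(q)}\chi^{-\lambda}(\sigma)\,q^{s_{\delta(\lambda)}(0)-1}\,g(\delta(\lambda))\,F_q\!\left(\gamma,\delta(\lambda),q^\times\,\Big|\,\frac{t}{\gamma^\gamma}\right).$$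
   Context: Characters. Put $q^\times=q-1$. Fix a non-trivial additive character $\psi:\mathbb{F}_q\to\mathbb{C}^\times$ and a multiplicative character $\chi:\mathbb{F}_q^\times\to\mathbb{C}^\times$ of order $q^\times$; $\chi^m(x)=\chi(x)^m$, $\zeta_k=e^{2\pi i/k}$. The Gauss sum is $g(m)=\sum_{u\in\mathbb{F}_q^\times}\psi(u)\chi^m(u)$ (it depends only on $m$ mod $q^\times$), and $g(v)=\prod_ig(v_i)$ for a vector $v$. Data attached to $f$. Let $m_i=(m_{i1},\dots,m_{i,d+2})\in\mathbb{Z}^{d+2}$ for $i=1,\dots,d$ and $\mathbf{1}=(1,\dots,1)\in\mathbb{Z}^{d+2}$. The Gale dual $\gamma\in\mathbb{Z}^{d+2}$ is the vector, unique up to sign, with $\sum_j\gamma_j=0$, $\sum_jm_{ij}\gamma_j=0$ for all $i$, and $\gcd(\gamma_1,\dots,\gamma_{d+2})=1$ (fix a choice of sign). Let $K=\{x\in\mathbb{Z}^{d+2}:\sum_j\gamma_jx_j=0\}$ and choose a $\mathbb{Z}$-basis $f_0=\mathbf{1},f_1,\dots,f_d$ of $K$; write $m_i=\sum_{l=1}^dc_{il}f_l+r_i\mathbf{1}$. Let $H=A\,(c_{il})$ with $A\in GL_d(\mathbb{Z})$ be the (upper triangular) Hermite normal form of $(c_{il})$ and put $\mathcal{N}=H^{T}$. Choose $\rho_1,\dots,\rho_d\in\mathbb{Z}^{d+2}$ with $\sum_j\rho_{kj}=0$ and $\sum_j\rho_{kj}f_{ij}=1$ if $i=k$, $=0$ if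 $i\ne k$ ($1\le i,k\le d$). (Then $Z$ is isomorphic to the variety in $\mathbb{P}^{d+1}\times\mathbb{G}_m^d$ given by $\sum_jw_j=0$, $\prod_jw_j\ne0$, $\prod_jw_j^{\gamma_j}=t$, $\prod_jw_j^{\rho_{kj}}=\sigma_k\prod_iz_i^{\mathcal{N}_{ki}}$.) Set $t=\prod_ju_j^{\gamma_j}$, $\sigma_k=\prod_ju_j^{\rho_{kj}}\in\mathbb{F}_q^\times$, $$\Lambda(q)=\Big\{\lambda\in(\mathbb{Z}/q^\times\mathbb{Z})^d:\ \sum_{k=1}^d\lambda_k\mathcal{N}_{ki}=0\text{ for }i=1,\dots,d\Big\},$$ and for $\lambda\in\Lambda(q)$ set $\delta(j,\lambda)=\sum_{k=1}^d\lambda_k\rho_{kj}\in\mathbb{Z}/q^\times\mathbb{Z}$, $\delta(\lambda)=(\delta(1,\lambda),\dots,\delta(d+2,\lambda))$, and $\chi^{-\lambda}(\sigma)=\prod_{k=1}^d\chi(\sigma_k)^{-\lambda_k}$. Finite hypergeometric sums. For $\delta\in(\mathbb{Z}/q^\times\mathbb{Z})^{d+2}$ let $D_\delta(T)$ be the greatest common divisor in $\mathbb{C}[T]$ of $\prod_{\gamma_j<0}(T^{-\gamma_j}-\zeta_{q^\times}^{\delta_j})$ and $\prod_{\gamma_j>0}(T^{\gamma_j}-\zeta_{q^\times}^{-\delta_j})$, and let $s_\delta(m)$ be the multiplicity of $e^{2\pi im/q^\times}$ as a zero of $D_\delta(T)$. For $q$ coprime to $\gamma_1\cdots\gamma_{d+2}$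 and $y\in\mathbb{F}_q^\times$, $$F_q(\gamma,\delta,q^\times\mid y)=\frac{1}{1-q}\sum_{m=0}^{q-2}\frac{g(-\gamma m+\delta)}{g(\delta)}\,q^{s_\delta(-m)-s_\delta(0)}\,\chi^m(\gamma^\gamma y),\qquad\gamma^\gamma=\prod_j\gamma_j^{\gamma_j}.$$ $\mathbb{P}_\Delta$ is the projective toric variety over $\mathbb{F}_q$ associated with the normal fan of $\Delta$; it contains $\mathbb{G}_m^d=\operatorname{Spec}\mathbb{F}_q[x_1^{\pm1},\dots,x_d^{\pm1}]$ as its dense torus. *)

(* Defs.v *)
From HB Require Import structures.
From mathcomp Require Import all_boot all_order all_algebra.
From mathcomp Require Import finmap complex.
From mathcomp Require Import all_classical all_reals all_analysis.

Set Implicit Arguments.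
Unset Strict Implicit.
Unset Printing Implicit Defensive.

Import Order.TTheory GRing.Theory Num.Theory.

Local Open Scope classical_set_scope.
Local Open Scope ring_scope.

(* F is the finite field F_q, so q = #|F| and q^x = q - 1 = #|F|.-1; the      *)
(* field of complex numbers is R[i].                                          *)

Section Characters.
Variables (R : realType) (F : finFieldType).

Definition additive_character (psi : F -> R[i]) : Prop :=
  psi 0 = 1 /\ {morph psi : x y / x + y >-> x * y}.

(* Characters of F^x are functions on F whose value at 0 is irrelevant: they  *)
(* are only ever evaluated at nonzero elements.                               *)
Definition multiplicative_character (chi : F -> R[i]) : Prop :=
  chi 1 = 1 /\ forall x y, x != 0 -> y != 0 -> chi (x * y) = chi x * chi y.

Definition character_order (chi : F -> R[i]) (n : nat) : Prop :=
  forall k : nat, (forall x, x != 0 -> chi x ^+ k = 1) <-> (n %| k)%N.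

(* Elements of Z/(q-1) are represented by integers throughout; everything     *)
(* below depends only on their residue classes.                               *)
Definition gauss (psi chi : F -> R[i]) (k : int) : R[i] :=
  \sum_(x : F | x != 0) psi x * chi x ^ k.

Definition gauss_vec (psi chi : F -> R[i]) (n : nat) (v : 'I_n -> int) : R[i] :=
  \prod_(j < n) gauss psi chi (v j).

End Characters.

Section FiniteHypergeometricSums.
Variables (R : realType) (F : finFieldType) (n : nat).
Implicit Types (gamma delta : 'I_n -> int).

Definition zeta (k : nat) : R[i] :=
  (cos (2 * pi / k%:R) +i* sin (2 * pi / k%:R))%C.

Definition D_poly gamma delta : {poly R[i]} :=
  gcdp
    (\prod_(j < n | gamma j < 0)
       ('X^(`|gamma j|%N) - (zeta #|F|.-1 ^ delta j)%:P))
    (\prod_(j < n | 0 < gamma j)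
       ('X^(`|gamma j|%N) - (zeta #|F|.-1 ^ (- delta j))%:P)).

Definition s_mult gamma delta (k : int) : nat :=
  mup (zeta #|F|.-1 ^ k) (D_poly gamma delta).

Definition gamma_gamma gamma : F := \prod_(j < n) (gamma j)%:~R ^ gamma j.

Definition hypergeometric_sum (psi chi : F -> R[i]) gamma delta (y : F) : R[i] :=
  (1 - #|F|%:R)^-1 *
  \sum_(k < #|F|.-1)
     gauss_vec psi chi (fun j => - gamma j * k%:Z + delta j) /
       gauss_vec psi chi delta *
     #|F|%:R ^ ((s_mult gamma delta (- k%:Z))%:Z - (s_mult gamma delta 0)%:Z) *
     chi (gamma_gamma gamma * y) ^+ k.

End FiniteHypergeometricSums.

Section GaleData.
Variable d : nat.

Definition gale_dual (m : 'M[int]_(d, d.+2)) (gamma : 'I_d.+2 -> int) : Prop :=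
  [/\ \sum_(j < d.+2) gamma j = 0,
      forall i, \sum_(j < d.+2) m i j * gamma j = 0
    & \big[gcdn/0%N]_(j < d.+2) `|gamma j|%N = 1%N].

(* The all-ones vector and the rows of fb form a Z-basis of K. *)
Definition kernel_basis (gamma : 'I_d.+2 -> int) (fb : 'M[int]_(d, d.+2)) : Prop :=
  (forall x : 'rV[int]_d.+2,
     (\sum_(j < d.+2) gamma j * x 0 j = 0) <->
     (exists (a : int) (b : 'rV[int]_d), x = const_mx a + b *m fb)) /\
  (forall (a : int) (b : 'rV[int]_d),
     const_mx a + b *m fb = 0 :> 'rV[int]_d.+2 -> a = 0 /\ b = 0).

(* Hermite normal form of a nonsingular square matrix under left              *)
(* multiplication by GL_d(Z): the pivots are the diagonal entries.            *)
Definition is_hermite (H : 'M[int]_d) : Prop :=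
  [/\ forall i k : 'I_d, (k < i)%N -> H i k = 0,
      forall i : 'I_d, 0 < H i i
    & forall i k : 'I_d, (i < k)%N -> 0 <= H i k < H k k].

Definition hermite_form_of (C H : 'M[int]_d) : Prop :=
  is_hermite H /\ exists A : 'M[int]_d, A \in unitmx /\ H = A *m C.

Definition dual_system (fb rho : 'M[int]_(d, d.+2)) : Prop :=
  (forall k, \sum_(j < d.+2) rho k j = 0) /\
  (forall i k, \sum_(j < d.+2) rho k j * fb i j = (i == k)%:R).

(* Elements of (Z/nZ)^d are given by representatives in {0, ..., n-1}; unlike *)
(* 'Z_n, this is also correct for n = 1, i.e. q = 2.                          *)
Definition Lambda (n : nat) (N : 'M[int]_d) : pred {ffun 'I_d -> 'I_n} :=
  [pred lam : {ffun 'I_d -> 'I_n} |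
    [forall i, (n %| \sum_(k < d) (lam k)%:Z * N k i)%Z]].

Definition delta_of (n : nat) (rho : 'M[int]_(d, d.+2)) (lam : {ffun 'I_d -> 'I_n})
  (j : 'I_d.+2) : int := \sum_(k < d) (lam k)%:Z * rho k j.

End GaleData.

(* Laurent polynomials over F in d variables: finitely supported functions on *)
(* the exponent lattice M = Z^d, i.e. elements of F[M].                       *)

Section Laurent.
Variables (F : fieldType) (d : nat).

Definition laurent := {fsfun 'cV[int]_d -> F with 0}.

Definition laurent_mul (f g : laurent) : laurent :=
  [fsfun n in [fset (a + b)%R | a in finsupp f, b in finsupp g]%fset =>
    \sum_(a <- finsupp f) f a * g (n - a)].

(* \sum_j u_j x^(m_j), where m_j is the j-th column of m *)
Definition laurent_of n (m : 'M[int]_(d, n)) (u : 'I_n -> F) : laurent :=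
  [fsfun e in [fset col j m | j in 'I_n]%fset => \sum_(j < n | col j m == e) u j].

Definition principal_ideal (f : laurent) : set laurent :=
  [set laurent_mul f h | h in [set: laurent]].

Definition laurent_eval (p : 'cV[int]_d -> F) (g : laurent) : F :=
  \sum_(e <- finsupp g) g e * p e.

End Laurent.

Section NewtonPolytope.
Variables (R : realType) (F : fieldType) (d : nat).

Definition to_real (e : 'cV[int]_d) : 'cV[R]_d := map_mx intr e.

Definition newton_polytope (f : laurent F d) : set 'cV[R]_d :=
  [set x | exists w : 'cV[int]_d -> R,
     [/\ forall e, 0 <= w e,
         \sum_(e <- finsupp f) w e = 1
       & x = \sum_(e <- finsupp f) w e *: to_real e]].

(* The direction space of the affine hull of the Newton polytope is spanned   *)
(* by the differences of exponents.                                           *)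
Definition newton_dim (f : laurent F d) : nat :=
  \dim <<[seq to_real a - to_real b | a <- finsupp f, b <- finsupp f]>>%VS.

End NewtonPolytope.

Arguments newton_polytope R {F d} f.
Arguments newton_dim R {F d} f.

Section NormalFan.
Variables (R : realType) (d : nat).
Implicit Types (P G s : set 'cV[R]_d).

Definition pairing (x v : 'cV[R]_d) : R := \sum_(i < d) x i 0 * v i 0.

(* nonempty faces; v = 0 gives P itself *)
Definition is_face P G : Prop :=
  G !=set0 /\
  exists v, G = [set x | P x /\ forall y, P y -> pairing x v <= pairing y v].

Definition normal_cone P G : set 'cV[R]_d :=
  [set v | forall x y, G x -> P y -> pairing x v <= pairing y v].

(* Inner normals, so that the monomials x^a with a in Z^d which are regular   *)
(* on the chart of the face G are those with a in the cone spanned by P - G.  *)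
Definition normal_fan P : set (set 'cV[R]_d) :=
  [set normal_cone P G | G in is_face P].

Definition cone_semigroup s : set 'cV[int]_d :=
  [set a | forall v, s v -> 0 <= pairing (to_real R a) v].

End NormalFan.

(* The toric variety X of a fan Sigma is glued from the affine charts         *)
(* U_s = Spec F[S_s], s in Sigma, along U_s /\ U_s' = U_(s /\ s'), where S_s  *)
(* is the semigroup [cone_semigroup s].  The dense torus is U_{0}.            *)

Section ToricVariety.
Variables (R : realType) (F : fieldType) (d : nat).
Local Notation cone := (set 'cV[R]_d).
Variable Sigma : set cone.

(* F-points of U_s are F-algebra morphisms F[S_s] -> F, i.e. morphisms from   *)
(* S_s to the multiplicative monoid of F.  They are represented by total      *)
(* functions on Z^d whose values outside S_s are irrelevant (two functions    *)
(* agreeing on S_s are identified by [glued]).                                *)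
Definition affine_point (s : cone) (p : 'cV[int]_d -> F) : Prop :=
  p 0 = 1 /\
  forall a b, cone_semigroup s a -> cone_semigroup s b -> p (a + b) = p a * p b.

Definition chart_point (x : cone * ('cV[int]_d -> F)) : Prop :=
  Sigma x.1 /\ affine_point x.1 x.2.

(* Two chart points coincide in X iff they both come from a point of the      *)
(* overlap U_(s /\ s').                                                       *)
Definition glued (x y : cone * ('cV[int]_d -> F)) : Prop :=
  exists p, [/\ affine_point (x.1 `&` y.1) p,
                forall a, cone_semigroup x.1 a -> p a = x.2 a
              & forall a, cone_semigroup y.1 a -> p a = y.2 a].

Definition toric_point (x : cone * ('cV[int]_d -> F)) :
    set (cone * ('cV[int]_d -> F)) :=
  [set y | chart_point y /\ glued x y].

Definition toric_points : set (set (cone * ('cV[int]_d -> F))) :=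
  [set toric_point x | x in chart_point].

(* For an ideal I of F[M], the closure in X of the closed subscheme V(I) of   *)
(* the torus Spec F[M] is cut out on the chart U_s by the ideal I /\ F[S_s].  *)
Definition in_closure (I : set (laurent F d)) (x : cone * ('cV[int]_d -> F)) :
    Prop :=
  forall g, I g -> (forall e, e \in finsupp g -> cone_semigroup x.1 e) ->
    laurent_eval x.2 g = 0.

Definition closure_points (I : set (laurent F d)) :
    set (set (cone * ('cV[int]_d -> F))) :=
  [set toric_point x | x in [set x | chart_point x /\ in_closure I x]].

End ToricVariety.

(* Main.v *)
Require Import Defs.
From mathcomp Require Import all_boot all_order all_algebra all_fingroup all_solvable all_field.
From mathcomp Require Import finmap complex.
From mathcomp Require Import all_classical all_reals all_analysis.
From mathcomp Require Import zify ring lra.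

Set Implicit Arguments.
Unset Strict Implicit.
Unset Printing Implicit Defensive.

Import Order.TTheory GRing.Theory Num.Theory.
Local Open Scope ring_scope.

(** Let o be the index of the negative entry of gamma, and q = #|F|. The
    relation sum_j gamma_j m_j = 0 says that the Newton polytope is the simplex
    spanned by the d+1 points m_j with j <> o, and that m_o is interior to it.

    Geometry. The cones of the normal fan correspond to the nonempty sets K of
    vertices [normal_fan_simplex]. Let M_K be the lattice of the integer
    vectors parallel to the face K. A point of the chart of a face J is a
    multiplicative function on the semigroup of J, and such a function is a
    homomorphism M_K -> F^x extended by 0, for exactly one face K containing J
    [monoid_point_orbit, orbit_point_inj]: the toric variety is the disjoint
    union of the tori O_K = Hom(M_K, F^x). The closure of Z meets O_K in the
    zero set of the part of f supported on the face K [in_closure_orbit], which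
    involves the u_j with j in K, and u_o only if K is the whole simplex. So the
    points of the closure are counted by a sum over K [closure_points_card].
    As M_K is a direct summand of Z^d, each point of O_K lifts to
    (q-1)^(d+1-|K|) points of the torus (F^x)^d [card_face_solutions], and it
    remains to count the torus solutions of the parts of f.

    Arithmetic. By Fourier inversion on F^x the additive character is a
    combination of multiplicative ones whose coefficients are Gauss sums g
    [gauss_inversion]. Hence the number of torus solutions of
    sum_(j in A) u_j x^(m_j) = 0 is a sum over the vectors mu modulo q-1 with
    sum_j mu_j = 0 and sum_j mu_j m_j = 0 which vanish outside A
    [count_hypersurface]. For a fixed mu, the sum over K is the expansion of a
    product over the vertices, and most of it cancels because g(0) = -1
    [sum_over_faces]. With G(mu) = prod_j g(mu_j) chi(u_j)^(- mu_j), the number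
    N of points satisfies [count_closure_scaled]
      q (q-1) N = q^(d+1) - q + sum_mu q^s(mu) G(mu),
    where s(mu) is 1 if mu_o and another coordinate of mu vanish, and 0
    otherwise. On the hypergeometric side, mu = - gamma k + sum_l lambda_l rho_l
    is a bijection from the pairs of a lambda in Lambda and a k modulo q-1 onto
    the same set of vectors [relation_chars_param], and s(mu) is the
    multiplicity of zeta^(- k) as a root of D_delta: a single factor comes
    from the negative entries, and its roots are simple
    [s_mult_one_negative]. *)

(** * Monomials on a split torus; characters and Gauss sums *)

Section Torus.
Variables (F : fieldType) (d : nat).
Implicit Types (x y : 'I_d -> F) (a b : 'cV[int]_d).

Definition monom x a : F := \prod_(i < d) x i ^ a i 0.

Lemma monom0 x : monom x 0 = 1.
Proof. by rewrite /monom big1 // => i _; rewrite mxE expr0z. Qed.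

Lemma monomD x a b : (forall i, x i != 0) ->
  monom x (a + b) = monom x a * monom x b.
Proof.
move=> x0; rewrite /monom -big_split; apply: eq_bigr => i _.
by rewrite mxE expfzDr.
Qed.

Lemma monom_neq0 x a : (forall i, x i != 0) -> monom x a != 0.
Proof. by move=> x0; apply/prodf_neq0 => i _; rewrite expfz_neq0. Qed.

Lemma monomM x y a : monom (fun i => x i * y i) a = monom x a * monom y a.
Proof.
by rewrite /monom -big_split; apply: eq_bigr => i _; rewrite expfzMl.
Qed.

End Torus.

Section MonomialMaps.
Variables (F : fieldType).

Lemma monom_ext d (x y : 'I_d -> F) a : x =1 y -> monom x a = monom y a.
Proof. by move=> xy; apply: eq_bigr => i _; rewrite xy. Qed.

Lemma monom_delta d (x : 'I_d -> F) i : monom x (delta_mx i 0) = x i.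
Proof.
rewrite /monom (bigD1 i) //= mxE !eqxx expr1z big1 ?mulr1 // => j ji.
by rewrite mxE (negbTE ji) expr0z.
Qed.

Lemma monom_sum d (x : 'I_d -> F) (I : finType) (a : I -> 'cV[int]_d) :
  (forall i, x i != 0) -> monom x (\sum_i a i) = \prod_i monom x (a i).
Proof.
move=> x0; apply: (big_morph (monom x)); last exact: monom0.
by move=> u v; exact: monomD.
Qed.

Lemma monomZ d (x : 'I_d -> F) (k : int) (a : 'cV[int]_d) : monom x (k *: a) = monom x a ^ k.
Proof.
rewrite /monom (big_morph (fun z : F => z ^ k) (fun u v => expfzMl u v _) (exp1rz _ _)).
by apply: eq_bigr => i _; rewrite mxE mulrC exprz_exp.
Qed.

Lemma monom_mulmx d e (x : 'I_d -> F) (P : 'M[int]_(d, e)) (a : 'cV[int]_e) :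
  (forall i, x i != 0) ->
  monom x (P *m a) = monom (fun j => monom x (col j P)) a.
Proof.
move=> x0; rewrite [in RHS]/monom.
have -> : P *m a = \sum_j a j 0 *: col j P.
  by apply/colP => i; rewrite mxE summxE; apply: eq_bigr => j _; rewrite !mxE mulrC.
by rewrite monom_sum //; apply: eq_bigr => j _; rewrite monomZ.
Qed.

End MonomialMaps.

Section FiniteTorus.
Variables (F : finFieldType).

Lemma card_units_gt0 : (0 < #|F|.-1)%N.
Proof. by rewrite -ltnS prednK ?finNzRing_gt1 // (ltn_trans _ (finNzRing_gt1 F)). Qed.

Lemma finField_generator :
  exists w : F, w != 0 /\ forall x : F, x != 0 -> exists k : nat, x = w ^+ k.
Proof.
have /cyclicP[w wE] := field_unit_group_cyclic [set: {unit F}]%G.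
exists (FinRing.uval w); split; first by rewrite -unitfE; case: (w).
move=> x x0; have ux : x \is a GRing.unit by rewrite unitfE.
have : FinRing.unit F ux \in <[w]>%g by rewrite -wE inE.
move=> /cycleP[k E]; exists k.
by have := congr1 (@FinRing.uval F) E; rewrite FinRing.val_unitX; apply.
Qed.

Definition torus d : {set {ffun 'I_d -> F}} :=
  [set x : {ffun 'I_d -> F} | [forall i, x i != 0]].

Lemma torusP d (x : {ffun 'I_d -> F}) : reflect (forall i, x i != 0) (x \in torus d).
Proof. by rewrite inE; exact: forallP. Qed.

(** Sums of products of functions of one coordinate factor, which turns
    character sums over the torus into products of character sums over F^x. *)
Lemma sum_torus (T : comNzRingType) d (h : 'I_d -> F -> T) :
  \sum_(x in torus d) \prod_i h i (x i) = \prod_i \sum_(z | z != 0) h i z.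
Proof.
rewrite bigA_distr_big; apply: eq_bigl => x; rewrite inE.
by apply/forallP/ffun_onP => H i; move: (H i).
Qed.

End FiniteTorus.
Arguments torus F d : clear implicits.

Section MultiplicativeCharacters.
Variables (R : realType) (F : finFieldType) (chi : F -> R[i]).
Hypothesis chiM : multiplicative_character chi.
Hypothesis chi_ord : character_order chi #|F|.-1.

Lemma char_neq0 x : x != 0 -> chi x != 0.
Proof.
move=> x0; apply/eqP => E; case: chiM => [c1 cM].
by move/eqP: c1; rewrite -(mulfV x0) cM ?invr_eq0 // E mul0r eq_sym oner_eq0.
Qed.

Lemma charX x (k : nat) : x != 0 -> chi (x ^+ k) = chi x ^+ k.
Proof.
move=> x0; case: chiM => [c1 cM].
by elim: k => [|k IH]; rewrite ?expr0 ?c1 // !exprS cM ?IH // expf_neq0.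
Qed.

Lemma charV x : x != 0 -> chi x^-1 = (chi x)^-1.
Proof.
move=> x0; case: chiM => [c1 cM]; apply: (mulfI (char_neq0 x0)).
by rewrite -cM ?invr_eq0 // !mulfV ?char_neq0.
Qed.

Lemma charXz x (k : int) : x != 0 -> chi (x ^ k) = chi x ^ k.
Proof.
move=> x0; case: k => k; first exact: charX.
by rewrite NegzE -!exprnN charV ?charX ?expf_neq0.
Qed.

Lemma char_prod (I : finType) (P : pred I) (h : I -> F) : (forall i, h i != 0) ->
  chi (\prod_(i | P i) h i) = \prod_(i | P i) chi (h i).
Proof.
move=> h0; case: chiM => [c1 cM].
suff [] : (\prod_(i | P i) h i != 0) /\
  chi (\prod_(i | P i) h i) = \prod_(i | P i) chi (h i) by [].
elim/big_rec2: _ => [|i z y _ [y0 E]]; first by rewrite oner_eq0.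
by rewrite mulf_neq0 // cM // E.
Qed.

Lemma char_monom d (x : 'I_d -> F) a : (forall i, x i != 0) ->
  chi (monom x a) = \prod_i chi (x i) ^ a i 0.
Proof.
move=> x0; rewrite /monom char_prod => [|i]; last by rewrite expfz_neq0.
by apply: eq_bigr => i _; rewrite charXz.
Qed.

(** The image of a generator of F^x has the same order q-1 as the generator. *)
Lemma char_faithful x : x != 0 -> chi x = 1 -> x = 1.
Proof.
move=> x0 cx; have [w [w0 wg]] := finField_generator F.
have [k xE] := wg x x0; rewrite xE charX // in cx.
have /chi_ord/dvdnP[l lE] : forall y, y != 0 -> chi y ^+ k = 1.
  move=> y y0; have [l ->] := wg y y0.
  by rewrite charX // exprAC cx expr1n.
rewrite xE lE mulnC exprM; suff -> : w ^+ #|F|.-1 = 1 by rewrite expr1n.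
by apply: (mulfI w0); rewrite mulr1 -exprS prednK ?expf_card // (ltn_trans _ (finNzRing_gt1 F)).
Qed.

Lemma sum_char_pow_eq0 (x : F) : x != 0 -> x != 1 ->
  \sum_(k < #|F|.-1) chi x ^+ k = 0.
Proof.
move=> x0 x1; have cn : chi x ^+ #|F|.-1 = 1 by apply/(chi_ord _).2.
have := subrX1 (chi x) #|F|.-1; rewrite cn subrr => /esym/eqP.
rewrite mulf_eq0 => /orP[|/eqP//]; rewrite subr_eq0 => /eqP /(char_faithful x0) E.
by rewrite E eqxx in x1.
Qed.

Lemma char_pow_modn (x : F) (k : int) : x != 0 ->
  chi x ^ (k %% #|F|.-1)%Z = chi x ^ k.
Proof.
move=> x0; rewrite [in RHS](divz_eq k #|F|.-1) [RHS](expfzDr _ _ (char_neq0 x0)).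
rewrite -[X in _ = X * _]exprz_exp exprzAC -exprnP.
have -> : chi x ^+ #|F|.-1 = 1 by apply/(chi_ord _).2.
by rewrite exp1rz mul1r.
Qed.

Lemma char_pow_eq1 (k : int) : (#|F|.-1 %| k)%Z ->
  forall x, x != 0 -> chi x ^ k = 1.
Proof.
by move=> /dvdz_mod0P k0 x x0; rewrite -char_pow_modn // k0.
Qed.

(** Multiplying the variable by some y with chi y ^ k <> 1 scales the sum by
    chi y ^ k, so the sum is zero unless the character is trivial. *)
Lemma sum_char_units (k : int) :
  \sum_(x : F | x != 0) chi x ^ k = (#|F|.-1)%:R *+ (#|F|.-1 %| k)%Z.
Proof.
have [kd|kd] := boolP (_ %| _)%Z.
  under eq_bigr => x x0 do rewrite char_pow_eq1 //.
  by rewrite sumr_const cardC1 mulr1n.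
have [y y0 cy] : exists2 y, y != 0 & chi y ^ k != 1.
  apply: contrapT => H; move/negP: kd; apply.
  have nn : (0 <= k %% #|F|.-1)%Z by apply: modz_ge0; have := card_units_gt0 F; lia.
  apply/dvdz_mod0P; have : (#|F|.-1 %| `|(k %% #|F|.-1)%Z|)%N.
    apply/chi_ord => x x0; rewrite exprnP gez0_abs // char_pow_modn //.
    by apply/eqP/negPn/negP => N; apply: H; exists x.
  move=> D; apply/eqP; rewrite -absz_eq0 -leqn0 leqNgt; apply/negP => P.
  have := dvdn_leq P D; have : (k %% #|F|.-1 < #|F|.-1)%Z.
    by apply: ltz_pmod; have := card_units_gt0 F; lia.
  by lia.
have : chi y ^ k * \sum_(x | x != 0) chi x ^ k = \sum_(x : F | x != 0) chi x ^ k.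
  rewrite [RHS](reindex_inj (mulfI y0)) mulr_sumr; apply: eq_big => x.
    by rewrite mulf_eq0 negb_or y0.
  by move=> x0; case: chiM => _ ->; rewrite ?expfzMl.
move/eqP; rewrite -subr_eq0 -[X in _ - X]mul1r -mulrBl mulf_eq0 subr_eq0 (negbTE cy).
by move/eqP ->.
Qed.

End MultiplicativeCharacters.

Section GaussSums.
Variables (R : realType) (F : finFieldType) (psi chi : F -> R[i]).
Hypothesis psiA : additive_character psi.
Hypothesis psi_nontrivial : exists x, psi x != 1.
Hypothesis chiM : multiplicative_character chi.
Hypothesis chi_ord : character_order chi #|F|.-1.
Local Notation n := (#|F|.-1).

Lemma natn_neq0 : n%:R != 0 :> R[i].
Proof. by rewrite pnatr_eq0 -lt0n card_units_gt0. Qed.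

Lemma natq_neq0 : #|F|%:R != 0 :> R[i].
Proof. by rewrite pnatr_eq0 -lt0n (ltn_trans _ (finNzRing_gt1 F)). Qed.

Lemma sum_addchar (z : F) : \sum_y psi (y * z) = #|F|%:R *+ (z == 0).
Proof.
case: psiA => psi0 psiD; case: eqP => [->|/eqP z0].
  under eq_bigr do rewrite mulr0 psi0; by rewrite sumr_const mulr1n.
case: psi_nontrivial => w pw.
have -> : \sum_y psi (y * z) = \sum_y psi y.
  by rewrite [RHS](reindex_inj (mulIf z0)).
have : psi w * \sum_y psi y = \sum_y psi y.
  rewrite [RHS](reindex_inj (addrI w)) mulr_sumr.
  by apply: eq_bigr => y _; rewrite psiD.
move/eqP; rewrite -subr_eq0 -[X in _ - X]mul1r -mulrBl mulf_eq0 subr_eq0 (negbTE pw).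
by move/eqP ->.
Qed.

Lemma gauss_modz k : gauss psi chi (k %% n)%Z = gauss psi chi k.
Proof. by apply: eq_bigr => x x0; rewrite char_pow_modn. Qed.

Lemma gauss_trivial k : (n %| k)%Z -> gauss psi chi k = -1.
Proof.
move=> nk; rewrite /gauss.
under eq_bigr => x x0 do rewrite (char_pow_eq1 chiM chi_ord) // mulr1.
have : \sum_y psi y = #|F|%:R *+ (1 == 0 :> F).
  by rewrite -sum_addchar; apply: eq_bigr => y _; rewrite mulr1.
case: psiA => psi0 _; rewrite (bigD1 0) //= psi0 oner_eq0 mulr0n.
by move/eqP; rewrite addrC addr_eq0 => /eqP.
Qed.

Lemma gauss_twist k (y : F) : y != 0 ->
  \sum_(x | x != 0) psi (y * x) * chi x ^ k = chi y ^ (- k) * gauss psi chi k.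
Proof.
move=> y0; rewrite /gauss mulr_sumr [RHS](reindex_inj (mulfI y0)) /=.
apply: eq_big => x; first by rewrite mulf_eq0 negb_or y0.
move=> x0; case: chiM => _ ->; rewrite // expfzMl.
have c0 := char_neq0 chiM y0.
rewrite mulrCA; congr (_ * _); rewrite mulrA -expfzDr // addNr expr0z mul1r //.
Qed.

(** The Fourier transform of chi ^ k is, up to nonzero factors, the constant
    g(k) [gauss_twist]. If g(k) were 0, Fourier inversion at 1 would give
    q * chi 1 ^ k = 0. *)
Lemma gauss_neq0 k : gauss psi chi k != 0.
Proof.
have [nk|nk] := boolP (n %| k)%Z; first by rewrite gauss_trivial // oppr_eq0 oner_eq0.
apply/eqP => g0; case: psiA => psi0 psiD.
have : \sum_y psi (- y) * (\sum_(x | x != 0) psi (y * x) * chi x ^ k) = 0.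
  apply: big1 => y _; have [->|y0] := eqVneq y 0; last by rewrite gauss_twist // g0 !mulr0.
  under eq_bigr do rewrite mul0r psi0 mul1r.
  by rewrite sum_char_units // (negbTE nk) mulr0n mulr0.
under eq_bigr do rewrite mulr_sumr.
rewrite exchange_big /= (bigD1 1) ?oner_eq0 //= [X in _ + X]big1.
  under eq_bigr do rewrite mulr1 mulrA -psiD addNr psi0 mul1r.
  case: chiM => -> _; rewrite exp1rz sumr_const addr0 => /eqP.
  by rewrite (negbTE natq_neq0).
move=> x /andP[x0 x1].
transitivity (\sum_y psi (y * (x - 1)) * chi x ^ k).
  by apply: eq_bigr => y _; rewrite mulrA -psiD mulrBr mulr1 addrC.
by rewrite -mulr_suml sum_addchar subr_eq0 (negbTE x1) mul0r.
Qed.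

(** Fourier inversion on F^x: exchange the sums and use that
    sum_k chi (x / z) ^ k is zero for x <> z. *)
Lemma gauss_inversion (z : F) : z != 0 ->
  psi z = n%:R^-1 * \sum_(k < n) gauss psi chi k * chi z ^ (- k%:Z).
Proof.
move=> z0; apply: (mulfI natn_neq0); rewrite mulVKf ?natn_neq0 //.
under eq_bigr do rewrite /gauss mulr_suml.
rewrite exchange_big /= (bigD1 z) //= [X in _ + X]big1.
  under eq_bigr do rewrite -mulrA -expfzDr ?char_neq0 // subrr expr0z mulr1.
  by rewrite sumr_const card_ord addr0 mulr_natl.
move=> x /andP[x0 xz].
have E (k : nat) : chi x ^ k * chi z ^ (- k%:Z) = chi (x / z) ^+ k.
  case: chiM => _ cM; rewrite cM ?invr_eq0 // charV // -exprz_inv exprMn //.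
under eq_bigr do rewrite -mulrA E.
rewrite -mulr_sumr sum_char_pow_eq0 ?mulr0 //.
  by rewrite mulf_neq0 ?invr_eq0.
by apply: contra xz => /eqP E1; rewrite -[x](mulfVK z0) E1 mul1r.
Qed.

End GaussSums.

(** * Points of a torus hypersurface by Gauss sums *)

Lemma prod_expfz (K : fieldType) (I : finType) (P : pred I) (x : K) (e : I -> int) :
  x != 0 -> \prod_(i | P i) x ^ e i = x ^ (\sum_(i | P i) e i).
Proof.
move=> x0; symmetry; apply: (big_morph (fun k : int => x ^ k)); last exact: expr0z.
by move=> a b; rewrite expfzDr.
Qed.

(** The vectors mu modulo n for which the character
    (y, x) |-> prod_j (y x^(m_j))^(mu_j) of the torus of dimension 1 + d is
    trivial, m_j being the columns of m. *)
Definition relation_chars (n d N : nat) (m : 'M[int]_(d, N)) : {set {ffun 'I_N -> 'I_n}} :=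
  [set mu : {ffun 'I_N -> 'I_n} | (n %| \sum_j (mu j)%:Z)%Z &&
     [forall i, (n %| \sum_j m i j * (mu j)%:Z)%Z]].

Section CountPoints.
Variables (R : realType) (F : finFieldType) (psi chi : F -> R[i]).
Hypothesis psiA : additive_character psi.
Hypothesis psi_nontrivial : exists x, psi x != 1.
Hypothesis chiM : multiplicative_character chi.
Hypothesis chi_ord : character_order chi #|F|.-1.
Local Notation n := (#|F|.-1).

Variables (d N : nat) (m : 'M[int]_(d, N)) (u : 'I_N -> F).
Hypothesis u0 : forall j, u j != 0.

Definition twisted_gauss j (k : nat) : R[i] :=
  gauss psi chi k * chi (u j) ^ (- k%:Z).

(** The Fourier coefficient at - k of z |-> psi (u_j z) if j is in A, and of
    the constant function 1 otherwise, so that the monomials in A and the absent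
    ones are treated alike. *)
Definition local_coef (A : {set 'I_N}) j (k : 'I_n) : R[i] :=
  if j \in A then n%:R^-1 * twisted_gauss j k else ((k == 0 :> nat)%:R).

Lemma local_expansion (A : {set 'I_N}) j (z : F) : z != 0 ->
  (if j \in A then psi (u j * z) else 1)
    = \sum_k local_coef A j k * chi z ^ (- (k : nat)%:Z).
Proof.
move=> z0; rewrite /local_coef; case: ifP => jA.
  rewrite (gauss_inversion psi chiM chi_ord) ?mulf_neq0 // mulr_sumr.
  apply: eq_bigr => k _; rewrite /twisted_gauss -!mulrA; congr (_ * (_ * _)).
  by case: chiM => _ ->; rewrite // expfzMl.
have n0 := card_units_gt0 F.
rewrite (bigD1 (Ordinal n0)) //= big1 ?addr0; first by rewrite oppr0 expr0z mulr1.
by move=> k /negbTE kn; rewrite -(val_eqE k) /= in kn; rewrite kn mul0r.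
Qed.

Lemma prod_char_monom (y : F) (x : {ffun 'I_d -> F}) (e : 'I_N -> int) :
  y != 0 -> (forall i, x i != 0) ->
  \prod_j chi (y * monom x (col j m)) ^ e j
    = chi y ^ (\sum_j e j) * \prod_i chi (x i) ^ (\sum_j m i j * e j).
Proof.
move=> y0 x0; rewrite -prod_expfz ?char_neq0 //.
transitivity (\prod_j (chi y ^ e j * \prod_i chi (x i) ^ (m i j * e j))).
  apply: eq_bigr => j _; case: chiM => _ ->; rewrite ?monom_neq0 // expfzMl.
  rewrite (char_monom chiM) // (big_morph (fun a : R[i] => a ^ e j)
    (fun a b => expfzMl a b _) (exp1rz _ _)); congr (_ * _).
  by apply: eq_bigr => i _; rewrite mxE exprz_exp.
rewrite big_split; congr (_ * _); rewrite exchange_big; apply: eq_bigr => i _.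
by rewrite prod_expfz ?char_neq0.
Qed.

Lemma card_torus : #|torus F d| = (n ^ d)%N.
Proof.
have : #|torus F d|%:R = \prod_(i < d) n%:R :> int.
  transitivity (\prod_(i < d) \sum_(z : F | z != 0) 1 : int).
    rewrite -(sum_torus (fun _ _ => 1)) -sumr_const.
    by apply: eq_bigr => x _; rewrite big1.
  by apply: eq_bigr => i _; rewrite sumr_const cardC1.
rewrite prodr_const card_ord -natrX => /eqP.
by rewrite eqr_nat => /eqP.
Qed.

(** Detect f(x) = 0 by sum_y psi (y f(x)), where f is the sum over A. The term
    y = 0 gives (q-1)^d. For y <> 0 the summand is a product over j, each factor
    is expanded into multiplicative characters, and summing over y and x keeps
    the vectors mu whose character is trivial, with weight (q-1)^(d+1). *)
Lemma count_hypersurface (A : {set 'I_N}) :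
  #|F|%:R * #|[set x in torus F d | \sum_(j in A) u j * monom x (col j m) == 0]|%:R
  = n%:R ^+ d + n%:R ^+ d.+1 *
      \sum_(mu in relation_chars n m) \prod_j local_coef A j (mu j) :> R[i].
Proof.
set f := fun x : {ffun 'I_d -> F} => \sum_(j in A) u j * monom x (col j m).
transitivity (\sum_(x in torus F d) \sum_y psi (y * f x)).
  under eq_bigr do rewrite (sum_addchar psiA psi_nontrivial).
  rewrite -sum1_card natr_sum mulr_sumr big_mkcond [RHS]big_mkcond /=.
  apply: eq_bigr => x _; rewrite inE; case: (x \in torus _ _) => //=.
  by rewrite -/(f x); case: eqP => _; rewrite ?mulr1 ?mulr0.
transitivity (\sum_(x in torus F d) (1 + \sum_(y | y != 0)
    \prod_j (if j \in A then psi (u j * (y * monom x (col j m))) else 1))).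
  apply: eq_bigr => x xT; rewrite (bigD1 0) //=; case: (psiA) => psi0 psiD.
  rewrite mul0r psi0; congr (_ + _); apply: eq_bigr => y _.
  rewrite -big_mkcond /= /f mulr_sumr.
  rewrite (big_morph psi psiD psi0); apply: eq_bigr => j _.
  by rewrite mulrCA.
rewrite big_split /= sumr_const card_torus natrX; congr (_ + _).
transitivity (\sum_(x in torus F d) \sum_(y | y != 0) \sum_(mu : {ffun 'I_N -> 'I_n})
    (\prod_j local_coef A j (mu j)) * (chi y ^ (\sum_j - (mu j)%:Z) *
      \prod_i chi (x i) ^ (\sum_j m i j * - (mu j)%:Z))).
  apply: eq_bigr => x /torusP xT; apply: eq_bigr => y y0.
  under eq_bigr => j _ do rewrite local_expansion ?mulf_neq0 ?monom_neq0 //.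
  rewrite bigA_distr_bigA; apply: eq_bigr => mu _.
  by rewrite big_split prod_char_monom.
transitivity (\sum_(mu : {ffun 'I_N -> 'I_n}) \sum_(x in torus F d) \sum_(y | y != 0)
    (\prod_j local_coef A j (mu j)) * (chi y ^ (\sum_j - (mu j)%:Z) *
      \prod_i chi (x i) ^ (\sum_j m i j * - (mu j)%:Z))).
  by rewrite [RHS]exchange_big /=; apply: eq_bigr => x _; rewrite exchange_big.
rewrite [X in _ * X]big_mkcond mulr_sumr; apply: eq_bigr => mu _.
transitivity ((\prod_j local_coef A j (mu j)) *
   ((\sum_(y | y != 0) chi y ^ (\sum_j - (mu j)%:Z)) *
     \sum_(x in torus F d) \prod_i chi (x i) ^ (\sum_j m i j * - (mu j)%:Z))).
  rewrite !mulr_sumr; apply: eq_bigr => x _.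
  by rewrite mulrCA -mulr_sumr -mulr_suml mulrCA.
rewrite sum_char_units //.
rewrite (sum_torus (fun i z => chi z ^ (\sum_j m i j * - (mu j)%:Z))).
have E1 : (\sum_j - (mu j)%:Z) = - \sum_j (mu j)%:Z by rewrite -sumrN.
have E2 i : (\sum_j m i j * - (mu j)%:Z) = - \sum_j m i j * (mu j)%:Z.
  by rewrite -sumrN; apply: eq_bigr => j _; rewrite mulrN.
rewrite (eq_bigr (fun i => n%:R *+ (n %| \sum_j m i j * (mu j)%:Z)%Z)); last first.
  by move=> i _; rewrite sum_char_units // E2 rpredN.
rewrite E1 rpredN inE; case: (_ %| _)%Z => /=; last by rewrite mulr0n mul0r !mulr0.
case: forallP => [H|/forallP]; last first.
  by rewrite negb_forall => /existsP[i /negbTE Hi]; rewrite (bigD1 i) //= Hi mulr0n mul0r !mulr0.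
rewrite [X in _ * (_ * X)](eq_bigr (fun=> n%:R)) => [|i _]; last by rewrite H mulr1n.
by rewrite prodr_const card_ord mulr1n -exprS mulrC.
Qed.

End CountPoints.

(** * Multiplicities of roots of unity *)

Section RootsOfUnity.
Variable R : realType.

Lemma zetaX (n k : nat) :
  zeta R n ^+ k = (cos ((2 * pi / n%:R) *+ k) +i* sin ((2 * pi / n%:R) *+ k))%C.
Proof.
elim: k => [|k IH]; first by rewrite expr0 mulr0n cos0 sin0.
rewrite exprS IH [in RHS]mulrS cosD sinD /zeta.
by apply/eqP; rewrite eq_complex /= eqxx /= addrC.
Qed.

(** The real part of zeta^k is 1 - 2 sin^2 (pi k / n), and the sine is positive
    for 0 < k < n. *)
Lemma zeta_prim (n : nat) : (0 < n)%N -> n.-primitive_root (zeta R n).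
Proof.
move=> n0; rewrite /primitive_root_of_unity n0 /=; apply/forallP => -[i ilt] /=.
have nR : (0 : R) < n%:R by rewrite ltr0n.
rewrite unity_rootE zetaX; apply/eqP.
have [E|ne] := eqVneq i.+1 n.
  have -> : 2 * pi / n%:R *+ i.+1 = pi *+ 2 :> R.
    by rewrite E -[LHS]mulr_natr mulfVK ?gt_eqF // mulr_natl.
  rewrite cos2pi sin2pi.
  by rewrite eq_complex /= !eqxx.
apply/negbTE; rewrite eq_complex /= negb_and; apply/orP; left.
pose a : R := pi / n%:R *+ i.+1.
have -> : 2 * pi / n%:R *+ i.+1 = a *+ 2.
  by rewrite /a -mulrA mulr_natl -!mulrnA mulnC.
rewrite cos_mulr2n cos2sin2.
have sa : 0 < sin a.
  apply: sin_gt0_pi; rewrite /a -[_ *+ i.+1]mulr_natr; apply/andP; split.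
    by rewrite mulr_gt0 ?divr_gt0 ?pi_gt0 ?ltr0n.
  rewrite -mulrA gtr_pMr ?pi_gt0 // mulrC ltr_pdivrMr // mul1r ltr_nat.
  by move: ilt ne; rewrite leq_eqVlt => /orP[/eqP->|]//; rewrite eqxx.
have := exprn_gt0 2 sa; move=> h; apply/eqP => E; move: h.
have -> : sin a ^+ 2 = 0 by lra.
by rewrite ltxx.
Qed.

Lemma zeta_neq0 n : (0 < n)%N -> zeta R n != 0.
Proof.
move=> n0; apply/eqP => E; have := prim_expr_order (zeta_prim n0).
by move/eqP; rewrite E expr0n eqn0Ngt n0 eq_sym oner_eq0.
Qed.

Lemma zeta_pow_eq1 n (a : int) : (0 < n)%N -> (zeta R n ^ a == 1) = (n %| a)%Z.
Proof.
move=> n0; rewrite dvdzE (prim_order_dvd (zeta_prim n0)).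
case: (intP a) => [|k|k]; rewrite ?expr0z ?abszN //=.
by rewrite -exprnN invr_eq1.
Qed.

Lemma zeta_pow_eq n (a b : int) : (0 < n)%N ->
  (zeta R n ^ a == zeta R n ^ b) = (n %| a - b)%Z.
Proof.
move=> n0; rewrite -zeta_pow_eq1 // expfzDr ?zeta_neq0 //.
rewrite -exprz_inv -[in RHS](inj_eq (mulIf (expfz_neq0 b (zeta_neq0 n0)))).
by rewrite -mulrA -expfzMl mulVf ?zeta_neq0 // exp1rz mulr1 mul1r.
Qed.

End RootsOfUnity.

(** In characteristic 0 the derivative of X^g - c vanishes at most at 0,
    which is not a root. *)
Lemma mup_binomial_le1 (K : numFieldType) (g : nat) (c z : K) :
  (0 < g)%N -> c != 0 -> (mup z ('X^g - c%:P) <= 1)%N.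
Proof.
move=> g0 c0.
have p0 : 'X^g - c%:P != 0 by rewrite -size_poly_gt0 size_XnsubC.
rewrite mup_leq //; apply/negP => /dvdpP[r E].
have : ('X^g - c%:P).[z] = 0 by rewrite E hornerM horner_exp hornerXsubC subrr expr0n mulr0.
rewrite !(hornerE, hornerXn) => /eqP; rewrite subr_eq0 => /eqP zg.
have z0 : z != 0 by apply: contra_neq c0 => z0; rewrite -zg z0 expr0n eqn0Ngt g0.
have /(congr1 (fun p => p^`().[z])) := E.
rewrite derivB derivXn derivC subr0 derivM expr2 derivM derivXsubC mulr1 mul1r.
rewrite !(hornerE, hornerXn, hornerMn) /= !subrr !mulr0 /= !add0r subrr mulr0 => /eqP.
by rewrite mulrn_eq0 expf_eq0 (negbTE z0) andbF orbF eqn0Ngt g0.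
Qed.

Lemma mup_gcdp (K : fieldType) (p q : {poly K}) z : p != 0 -> q != 0 ->
  mup z (gcdp p q) = minn (mup z p) (mup z q).
Proof.
move=> p0 q0; have g0 : gcdp p q != 0 by rewrite gcdp_eq0 negb_and p0.
apply/eqP; rewrite eqn_leq leq_min; apply/andP; split.
  rewrite !mup_geq //; have : (('X - z%:P) ^+ mup z (gcdp p q) %| gcdp p q) by rewrite -mup_geq.
  by rewrite dvdp_gcd.
by rewrite mup_geq // dvdp_gcd -!mup_geq // geq_minl geq_minr.
Qed.

(** The first product in D_delta is the single binomial of the index o, with
    simple roots, so the multiplicity of a root of the gcd is 1 or 0 according
    to whether it is a common root. *)
Lemma s_mult_one_negative (R : realType) (F : finFieldType) N (gamma delta : 'I_N -> int)
    (o : 'I_N) (k : int) :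
  (forall j, (gamma j < 0) = (j == o)) -> (forall j, (0 < gamma j) = (j != o)) ->
  s_mult R F gamma delta (- k) =
   ((#|F|.-1 %| - gamma o * k + delta o)%Z &&
     [exists j, (j != o) && (#|F|.-1 %| - gamma j * k + delta j)%Z]) :> nat.
Proof.
move=> gneg gpos; have n0 := card_units_gt0 F.
have z0 : zeta R #|F|.-1 != 0 by apply: zeta_neq0.
rewrite /s_mult /D_poly; under eq_bigl do rewrite gneg; rewrite big_pred1_eq.
set P := 'X^_ - _; set Q := \prod_(j < N | _) _; set z := zeta _ _ ^ _.
have g0 j : (0 < `|gamma j|)%N.
  rewrite absz_gt0; apply/eqP => E; have := gneg j; have := gpos j.
  by rewrite E ltxx; case: eqP.
have P0 : P != 0 by rewrite -size_poly_gt0 size_XnsubC.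
have Q0 : Q != 0.
  by apply/prodf_neq0 => j _; rewrite -size_poly_gt0 size_XnsubC.
rewrite mup_gcdp //.
have P1 : (mup z P <= 1)%N by apply: mup_binomial_le1; rewrite ?expfz_neq0.
have rP : root P z = (#|F|.-1 %| - gamma o * k + delta o)%Z.
  rewrite /root /P !hornerE subr_eq0 /z exprnP exprz_exp zeta_pow_eq //.
  rewrite -[LHS]rpredN; congr (_ %| _)%Z.
  by have := gneg o; rewrite eqxx; nia.
have rQ : root Q z = [exists j, (j != o) && (#|F|.-1 %| - gamma j * k + delta j)%Z].
  rewrite /root /Q horner_prod; apply/prodf_eq0/existsP => -[j].
    rewrite gpos => jo; rewrite !hornerE subr_eq0 /z exprnP exprz_exp zeta_pow_eq // => H.
    exists j; rewrite jo /=; move: H; congr (is_true (_ %| _)%Z).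
    by have := gpos j; rewrite jo; lia.
  move=> /andP[jo H]; exists j; first by rewrite gpos.
  rewrite !hornerE subr_eq0 /z exprnP exprz_exp zeta_pow_eq //.
  move: H; congr (is_true (_ %| _)%Z).
  by have := gpos j; rewrite jo; lia.
rewrite -rP -rQ -(dvdp_XsubCl P) XsubC_dvd // -(dvdp_XsubCl Q) XsubC_dvd //.
by move: P1; move: (mup z P) (mup z Q) => a b; lia.
Qed.

(** * Characters annihilating the exponents, parametrized by the Gale dual *)

(** Used for gamma: a vector e with e . gamma = 1 recovers the coordinate k
    of - gamma k + sum_l lambda_l rho_l. *)
Lemma bezout_vector N (g : 'I_N -> int) :
  exists e : 'I_N -> int, \sum_j e j * g j = (\big[gcdn/0%N]_(j < N) `|g j|%N)%:Z.
Proof.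
elim: N g => [|N IH] g; first by exists (fun=> 0); rewrite !big_ord0.
have [e E] := IH (fun j => g (lift ord0 j)).
have [a [b ab]] := Bezoutz (g ord0) (\big[gcdn/0%N]_(j < N) `|g (lift ord0 j)|%N)%:Z.
exists (fun j => if unlift ord0 j is Some j' then b * e j' else a).
rewrite !big_ord_recl unlift_none.
under eq_bigr do rewrite liftK -mulrA.
by rewrite -mulr_sumr E ab /gcdz /=.
Qed.

Section Residues.
Variable n : nat.
Hypothesis n_gt0 : (0 < n)%N.

Lemma residue_subproof (k : int) : (`|(k %% n)%Z| < n)%N.
Proof.
have n0 : n%:Z != 0 by lia.
by have := modz_ge0 k n0; have := @ltz_pmod k n ltac:(lia); lia.
Qed.

Definition residue (k : int) : 'I_n := Ordinal (residue_subproof k).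

Lemma residueE k : (residue k : nat)%:Z = (k %% n)%Z.
Proof. by rewrite /= gez0_abs // modz_ge0 //; lia. Qed.

Definition vdvd p (x : 'cV[int]_p) : Prop := forall i, (n %| x i ord0)%Z.

Lemma vdvdD p (x y : 'cV[int]_p) : vdvd x -> vdvd y -> vdvd (x + y).
Proof. by move=> dx dy i; rewrite mxE rpredD. Qed.

Lemma vdvdN p (x : 'cV[int]_p) : vdvd x -> vdvd (- x).
Proof. by move=> dx i; rewrite mxE rpredN. Qed.

Lemma vdvdM p r (A : 'M[int]_(r, p)) (x : 'cV[int]_p) : vdvd x -> vdvd (A *m x).
Proof. by move=> dx i; rewrite mxE rpred_sum // => j _; rewrite dvdz_mull. Qed.

Definition intvec p (mu : {ffun 'I_p -> 'I_n}) : 'cV[int]_p := \col_j (mu j : nat)%:Z.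
Definition reduce p (x : 'cV[int]_p) : {ffun 'I_p -> 'I_n} := [ffun j => residue (x j ord0)].

Lemma reduce_congr p (x : 'cV[int]_p) : vdvd (x - intvec (reduce x)).
Proof.
move=> i; rewrite !mxE ffunE residueE.
by rewrite [X in (X - _)%R](divz_eq (x i ord0) n) addrK dvdz_mull.
Qed.

Lemma intvec_inj p (mu nu : {ffun 'I_p -> 'I_n}) :
  vdvd (intvec mu - intvec nu) -> mu = nu.
Proof.
move=> H; apply/ffunP => i; apply: val_inj => /=; have := H i; rewrite !mxE.
have := ltn_ord (mu i); have := ltn_ord (nu i).
move: (nat_of_ord _) (nat_of_ord _) => a b an bn /=; rewrite dvdzE /= => D.
case: (posnP `|a%:Z - b%:Z|%N) => [|w]; first by lia.
by have := dvdn_leq w D; lia.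
Qed.

Lemma reduce_eq p (x y : 'cV[int]_p) : vdvd (x - y) -> reduce x = reduce y.
Proof.
move=> xy; apply: intvec_inj; move: (vdvdD (vdvdN (reduce_congr x)) (vdvdD xy (reduce_congr y))).
by rewrite opprB !subrKA.
Qed.

Lemma intvecK p : cancel (@intvec p) (@reduce p).
Proof.
by move=> mu; apply: intvec_inj; rewrite -opprB; apply/vdvdN/reduce_congr.
Qed.

Lemma residue_eq a b : (n %| a - b)%Z -> residue a = residue b.
Proof.
move=> ab; apply: val_inj => /=; congr absz; apply/eqP.
by rewrite eqz_mod_dvd.
Qed.

Lemma residueK (k : 'I_n) : residue (k : nat)%:Z = k.
Proof. by apply: val_inj; rewrite /= modz_nat /= modn_small. Qed.

Lemma vdvd_congr p r (A : 'M[int]_(r, p)) (x y : 'cV[int]_p) :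
  vdvd (x - y) -> vdvd (A *m x) <-> vdvd (A *m y).
Proof.
move=> xy; have D : vdvd (A *m x - A *m y) by rewrite -mulmxBr; apply: vdvdM.
split => h; first by rewrite -[A *m y](subKr (A *m x)); apply: vdvdD => //; apply: vdvdN.
by rewrite -[A *m x](subrK (A *m y)); apply: vdvdD.
Qed.

End Residues.

Lemma sub_scalar11 (X : 'M[int]_1) k : (X - k *: 1%:M) 0 0 = X 0 0 - k.
Proof. by rewrite !mxE eqxx mulr1. Qed.

Section Parametrization.
Variables (n d : nat) (n_gt0 : (0 < n)%N).
Variables (gamma : 'I_d.+2 -> int) (m fb rho : 'M[int]_(d, d.+2)).
Variables (c H : 'M[int]_d) (b : 'cV[int]_d).
Hypothesis galeP : gale_dual m gamma.
Hypothesis kerP : kernel_basis gamma fb.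
Hypothesis mE : m = c *m fb + (\matrix_(i < d, j < d.+2) b i 0).
Hypothesis hermP : hermite_form_of c H.
Hypothesis dualP : dual_system fb rho.

Let g : 'cV[int]_d.+2 := \col_j gamma j.
Let one : 'rV[int]_d.+2 := const_mx 1.
Local Notation vdvd := (vdvd n).

Let sum_g (y : 'rV[int]_d.+2) : y *m g = (\sum_j gamma j * y 0 j)%:M.
Proof.
by apply/rowP => i; rewrite ord1 !mxE eqxx mulr1n; apply: eq_bigr => j _; rewrite mxE mulrC.
Qed.

Let row_one (y : 'cV[int]_d.+2) : one *m y = (\sum_j y j 0)%:M.
Proof.
apply/rowP => i; rewrite ord1 !mxE eqxx mulr1n.
by apply: eq_bigr => j _; rewrite mxE mul1r.
Qed.

Let one_g : one *m g = 0.
Proof.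
case: galeP => g0 _ _; rewrite row_one; under eq_bigr do rewrite mxE.
by rewrite g0 raddf0.
Qed.

Let fb_g : fb *m g = 0.
Proof.
apply/row_matrixP => i; rewrite row_mul sum_g row0.
have -> : \sum_j gamma j * row i fb 0 j = 0; last by rewrite raddf0.
apply/kerP.1; exists 0, (delta_mx 0 i); rewrite -rowE.
by apply/rowP => j; rewrite !mxE add0r.
Qed.

Let mE1 : m = c *m fb + b *m one.
Proof.
rewrite mE; congr (_ + _); apply/matrixP => i j; rewrite !mxE.
by rewrite big_ord_recl big_ord0 !mxE mulr1 addr0.
Qed.

Let m_g : m *m g = 0.
Proof. by rewrite mE1 mulmxDl -!mulmxA fb_g one_g !mulmx0 addr0. Qed.

Let one_rho : one *m rho^T = 0.
Proof.
apply/rowP => k; rewrite !mxE; case: dualP => r0 _; rewrite -[RHS](r0 k).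
by apply: eq_bigr => j _; rewrite !mxE mul1r.
Qed.

Let fb_rho : fb *m rho^T = 1%:M.
Proof.
apply/matrixP => i k; rewrite !mxE; case: dualP => _ <-.
by apply: eq_bigr => j _; rewrite !mxE mulrC.
Qed.

Let m_rho : m *m rho^T = c.
Proof. by rewrite mE1 mulmxDl -!mulmxA fb_rho one_rho mulmx0 mulmx1 addr0. Qed.

Let bezout_row : exists e : 'rV[int]_d.+2, e *m g = 1%:M.
Proof.
have [e E] := bezout_vector gamma; case: galeP => _ _ G; rewrite G in E.
exists (\row_j e j); rewrite sum_g; congr (_ %:M); rewrite -[RHS]E.
by apply: eq_bigr => j _; rewrite mxE mulrC.
Qed.

(** The rows one and fb span the orthogonal of gamma, and e . gamma = 1, so
    together they span Z^(d+2): a vector is zero modulo n as soon as its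
    products with these rows are. *)
Let vdvd_detect (e : 'rV[int]_d.+2) (x : 'cV[int]_d.+2) : e *m g = 1%:M ->
  vdvd (one *m x) -> vdvd (fb *m x) -> vdvd (e *m x) -> vdvd x.
Proof.
move=> eg d1 df de j; pose y : 'rV[int]_d.+2 := delta_mx 0 j - (delta_mx 0 j *m g) *m e.
have /kerP.1 : \sum_j gamma j * y 0 j = 0.
  have : y *m g = 0 by rewrite /y mulmxBl -(mulmxA _ e) eg mulmx1 subrr.
  by rewrite sum_g => /rowP/(_ 0); rewrite !mxE eqxx mulr1n.
move=> [a [z yE]].
have dE : delta_mx 0 j = (delta_mx 0 j *m g) *m e + (a%:M *m one + z *m fb) :> 'rV[int]_d.+2.
  rewrite -[LHS](subrK ((delta_mx 0 j *m g) *m e)) -/y addrC yE; congr (_ + (_ + _)).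
  by rewrite mul_scalar_mx /one scalemx_const mulr1.
have : vdvd ((delta_mx 0 j : 'rV[int]_d.+2) *m x).
  rewrite dE mulmxDl (mulmxDl (_ *m one)) -!(mulmxA _ _ x).
  by do ?apply: vdvdD; apply: vdvdM.
by move=> /(_ 0); rewrite -rowE mxE.
Qed.

(** The passage to the Hermite form multiplies by a unimodular matrix, which
    does not change the congruence conditions. *)
Let hermite_dvd (x : 'cV[int]_d) : vdvd (H *m x) <-> vdvd (c *m x).
Proof.
case: hermP => _ [A [uA HE]]; rewrite HE; split => D; last first.
  by rewrite -mulmxA; apply: vdvdM.
have -> : c *m x = invmx A *m (A *m c *m x) by rewrite !mulmxA mulVmx // mul1mx.
exact: vdvdM.
Qed.

Definition param_char (p : {ffun 'I_d -> 'I_n} * 'I_n) : {ffun 'I_d.+2 -> 'I_n} :=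
  reduce n_gt0 (\col_j (- gamma j * (p.2 : nat)%:Z + delta_of rho p.1 j)).

Let relvec (p : {ffun 'I_d -> 'I_n} * 'I_n) := rho^T *m intvec p.1 - (p.2 : nat)%:Z *: g.

Let param_charE p : param_char p = reduce n_gt0 (relvec p).
Proof.
congr reduce; apply/colP => j; rewrite !mxE mulNr [LHS]addrC [gamma j * _]mulrC; congr (_ + _).
by apply: eq_bigr => l _; rewrite !mxE mulrC.
Qed.

Let one_relvec p : one *m relvec p = 0.
Proof. by rewrite mulmxBr mulmxA one_rho mul0mx -scalemxAr one_g scaler0 subr0. Qed.

Let fb_relvec p : fb *m relvec p = intvec p.1.
Proof. by rewrite mulmxBr mulmxA fb_rho mul1mx -scalemxAr fb_g scaler0 subr0. Qed.

Let m_relvec p : m *m relvec p = c *m intvec p.1.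
Proof. by rewrite mulmxBr mulmxA m_rho -scalemxAr m_g scaler0 subr0. Qed.

Let relP (mu : {ffun 'I_d.+2 -> 'I_n}) :
  reflect (vdvd (one *m intvec mu) /\ vdvd (m *m intvec mu)) (mu \in relation_chars n m).
Proof.
have E i : (m *m intvec mu) i 0 = \sum_j m i j * (mu j : nat)%:Z.
  by rewrite mxE; apply: eq_bigr => j _; rewrite mxE.
have E1 i : (one *m intvec mu) i 0 = \sum_j (mu j : nat)%:Z.
  by rewrite mxE; apply: eq_bigr => j _; rewrite !mxE mul1r.
rewrite inE; apply: (iffP andP) => -[h1 h2]; split.
- by move=> i; rewrite E1.
- by move=> i; rewrite E; move/forallP: h2.
- by have := h1 0; rewrite E1.
- by apply/forallP => i; rewrite -E.
Qed.

Let LambdaP (lam : {ffun 'I_d -> 'I_n}) : reflect (vdvd (H *m intvec lam)) (Lambda H^T lam).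
Proof.
have E i : (H *m intvec lam) i 0 = \sum_k (lam k : nat)%:Z * H^T k i.
  by rewrite mxE; apply: eq_bigr => j _; rewrite !mxE mulrC.
apply: (iffP forallP) => h i; first by rewrite E.
by rewrite -E.
Qed.

(** The inverse sends mu to lambda = fb . mu, by duality between fb and rho,
    and to the k obtained by pairing sum_l lambda_l rho_l - mu with a vector e
    such that e . gamma = 1. As m . rho = c, the condition m . mu = 0 on the
    parametrized vector reads c . lambda = 0, that is, lambda is in Lambda.
    The second conjunct has the shape of the side condition of
    [reindex_onto]. *)
Lemma relation_chars_param : exists2 h' : {ffun 'I_d.+2 -> 'I_n} -> {ffun 'I_d -> 'I_n} * 'I_n,
   (forall mu, mu \in relation_chars n m -> param_char (h' mu) = mu) &
   (forall p, (param_char p \in relation_chars n m) && (h' (param_char p) == p) = Lambda H^T p.1).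
Proof.
have [e eg] := bezout_row.
pose lam (mu : {ffun 'I_d.+2 -> 'I_n}) := reduce n_gt0 (fb *m intvec mu).
pose kap mu := residue n_gt0 ((e *m (rho^T *m intvec (lam mu) - intvec mu)) 0 0).
exists (fun mu => (lam mu, kap mu)) => [mu /relP[mu1 mum]|p].
  rewrite param_charE -[RHS](intvecK n_gt0).
  apply: reduce_eq; apply: (vdvd_detect eg).
  - by rewrite mulmxBr one_relvec sub0r; apply: vdvdN.
  - rewrite mulmxBr fb_relvec /=.
    by rewrite -opprB; apply/vdvdN/reduce_congr.
  - rewrite /relvec addrAC mulmxBr -scalemxAr eg /= => i.
    rewrite ord1 sub_scalar11 /kap residueE ?n_gt0 //.
    by rewrite [X in (_ %| X - _)%Z](divz_eq _ n) addrK dvdz_mull.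
have w := reduce_congr n_gt0 (relvec p); rewrite -param_charE in w.
have lamE : lam (param_char p) = p.1.
  rewrite -[RHS](intvecK n_gt0) -fb_relvec; apply/esym/reduce_eq.
  by rewrite -mulmxBr; apply: vdvdM.
have -> : (lam (param_char p), kap (param_char p)) == p.
  rewrite [X in _ == X]surjective_pairing lamE xpair_eqE eqxx /=; apply/eqP.
  rewrite -[RHS](residueK n_gt0) /kap lamE; apply: residue_eq.
  have : vdvd (e *m (relvec p - intvec (param_char p))) by apply: vdvdM.
  rewrite /relvec addrAC mulmxBr -scalemxAr eg => /(_ 0).
  by rewrite sub_scalar11 -opprB rpredN.
rewrite andbT; apply/relP/LambdaP => [[_ hm]|hl].
  by apply/hermite_dvd; rewrite -m_relvec; exact/(vdvd_congr m w).
split; first by apply/(vdvd_congr one w); rewrite one_relvec => i; rewrite mxE dvdz0.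
by apply/(vdvd_congr m w); rewrite m_relvec; apply/hermite_dvd.
Qed.

End Parametrization.

(** * Saturated sublattices *)

Section SaturatedSublattice.
Variables (F : finFieldType) (d p : nat) (A : 'M[int]_(p, d)).

Lemma card_torus_trivial (I : {set 'I_d}) :
  #|[set y in torus F d | [forall i, (i \notin I) ==> (y i == 1)]]| = (#|F|.-1 ^ #|I|)%N.
Proof.
set Y := [set y in torus F d | _]; have : #|Y|%:R
   = \prod_(i < d) (if i \in I then #|F|.-1%:R else 1) :> int.
  transitivity (\prod_(i < d) \sum_(z : F | z != 0) ((i \notin I) ==> (z == 1))%:R : int).
    rewrite -(sum_torus (fun i z => ((i \notin I) ==> (z == 1))%:R)) -sum1_card natr_sum.
    rewrite big_mkcond [RHS]big_mkcond; apply: eq_bigr => y _; rewrite inE.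
    case: (y \in torus F d) => //=; case: forallP => [H|/forallP].
      by rewrite big1 // => i _; rewrite H.
    by rewrite negb_forall => /existsP[i /negbTE H]; rewrite (bigD1 i) //= H mul0r.
  apply: eq_bigr => i _; case: (i \in I) => /=; first by rewrite sumr_const cardC1.
  rewrite (bigD1 1) ?oner_eq0 //= eqxx big1 ?addr0 // => z /andP[_ /negbTE ->] //.
rewrite -big_mkcond /= prodr_const -natrX => /eqP.
by rewrite eqr_nat => /eqP.
Qed.

(** Kernels of integer matrices are direct summands: in the coordinates given
    by the Smith normal form the kernel is a coordinate subspace, and E is the
    coordinate projection. The points of the torus killed by E are those whose
    new coordinates are arbitrary on the r pivots and 1 elsewhere. *)
Lemma integer_kernel_projector :
  exists2 E : 'M[int]_d,
   (forall a : 'cV[int]_d, A *m (E *m a) = 0) /\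
   (forall a : 'cV[int]_d, A *m a = 0 -> E *m a = a) &
   exists2 r : nat, \tr E = d%:Z - r%:Z &
     #|[set z in torus F d | [forall k, monom z (col k E) == 1]]| = (#|F|.-1 ^ r)%N.
Proof.
have [L uL [Rm uR [ds _ AE]]] := int_Smith_normal_form A.
set Dg := \matrix_(i, j) _ in AE.
pose I := [set i : 'I_d | (ds`_i != 0) && (i < p)%N].
pose P := invmx Rm.
pose Dm : 'M[int]_d := diag_mx (\row_i (i \notin I)%:R).
have PR : P *m Rm = 1%:M by rewrite mulVmx.
have RP : Rm *m P = 1%:M by rewrite mulmxV.
have kerE (a : 'cV[int]_d) : A *m a = 0 <-> forall i, i \in I -> (Rm *m a) i 0 = 0.
  rewrite AE -!mulmxA; have LD y : L *m (Dg *m y) = 0 <-> Dg *m y = 0 :> 'cV[int]_p.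
    split => [H|->]; last by rewrite mulmx0.
    by rewrite -[LHS](mulKmx uL) H mulmx0.
  rewrite LD; split => [H i|H].
    rewrite inE => /andP[di ip]; have := congr1 (fun M : 'cV[int]_p => M (Ordinal ip) 0) H.
    rewrite mxE [RHS]mxE (bigD1 i) //= mxE /= eqxx mulr1n big1 ?addr0 => [|j ji].
      by move/eqP; rewrite mulf_eq0 (negbTE di) => /eqP.
    by rewrite mxE /= eq_sym (inj_eq val_inj) (negbTE ji) mulr0n mul0r.
  apply/colP => i; rewrite mxE [RHS]mxE; apply: big1 => j _; rewrite mxE.
  case: eqP => [ij|]; last by rewrite mulr0n mul0r.
  have [->|di] := eqVneq ds`_i 0; first by rewrite mul0rn mul0r.
  by rewrite H ?mulr0 // inE -ij di /=.
have DmE (y : 'cV[int]_d) i : (Dm *m y) i 0 = (i \notin I)%:R * y i 0.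
  by rewrite mul_diag_mx !mxE.
exists (P *m Dm *m Rm).
  split => a; rewrite -!mulmxA.
    by apply/kerE => i iI; rewrite mulmxA RP mul1mx DmE iI mul0r.
  move/kerE => H; have -> : Dm *m (Rm *m a) = Rm *m a.
    apply/colP => i; rewrite DmE; case: (boolP (i \in I)) => [iI|]; last by rewrite mul1r.
    by rewrite H // mulr0.
  by rewrite mulmxA PR mul1mx.
exists #|I|.
  rewrite -mulmxA mxtrace_mulC -mulmxA RP mulmx1 /mxtrace.
  under eq_bigr do rewrite !mxE eqxx mulr1n.
  rewrite -natr_sum.
  have -> : (\sum_(i < d) (i \notin I))%N = #|~: I|.
    rewrite -sum1_card [RHS]big_mkcond; apply: eq_bigr => i _.
    by rewrite finset.in_setC; case: (i \in I).
  by have := cardsC I; rewrite card_ord natz; lia.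
rewrite -card_torus_trivial.
pose phi (M : 'M[int]_d) (z : {ffun 'I_d -> F}) : {ffun 'I_d -> F} :=
  [ffun j => monom z (col j M)].
have phiT M z : z \in torus F d -> phi M z \in torus F d.
  by move=> /torusP zT; apply/torusP => j; rewrite ffunE monom_neq0.
have phiE M z a : z \in torus F d -> monom (phi M z) a = monom z (M *m a).
  move=> /torusP zT; rewrite monom_mulmx //; apply: monom_ext => j; exact: ffunE.
have phiK M M' z : M *m M' = 1%:M -> z \in torus F d -> phi M' (phi M z) = z.
  move=> MM zT; apply/ffunP => j; rewrite ffunE phiE //.
  by rewrite colE mulmxA MM mul1mx monom_delta.
rewrite -(@card_in_imset _ _ (phi P)); last first.
  move=> z z'; rewrite !inE => /andP[zT _] /andP[zT' _] E.
  by rewrite -(phiK P Rm z PR) ?inE // E phiK ?inE.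
apply: eq_card => y; apply/imsetP/idP => [[z zin ->]|].
  move: zin; rewrite inE => /andP[zT /forallP Hz]; rewrite inE phiT //=.
  apply/forallP => i; apply/implyP => iI; rewrite ffunE.
  have -> : col i P = (P *m Dm *m Rm) *m (col i P).
    rewrite [in RHS]colE -!mulmxA (mulmxA Rm) RP mul1mx [in LHS]colE; congr (_ *m _).
    apply/colP => j; rewrite DmE !mxE eqxx andbT; case: eqP => [->|]; last by rewrite mulr0.
    by rewrite iI mulr1.
  move/torusP: zT => zT; rewrite monom_mulmx // {1}/monom big1 // => k _.
  by rewrite (eqP (Hz k)) exp1rz.
rewrite inE => /andP[yT /forallP Hy]; exists (phi Rm y); last by rewrite phiK.
rewrite inE phiT //=; apply/forallP => k; rewrite phiE // colE -!mulmxA (mulmxA Rm) RP mul1mx.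
rewrite /monom big1 // => i _; rewrite DmE.
have := Hy i; case: (i \in I) => /=; first by rewrite mul0r expr0z.
by move/eqP => ->; rewrite exp1rz.
Qed.

End SaturatedSublattice.

(** * Lattice simplices *)

(** A d-simplex with integer vertices, with its barycentric coordinates cleared
    of denominators: the i-th coordinate of a, times scale, is
    (bary *m a)_i + offset_i. The three equations say that these affine
    functions are dual to the vertices, that their linear parts sum to 0, and
    that combining the vertices with the linear parts gives back scale * a. *)
Record lattice_simplex (d : nat) := LatticeSimplex {
  vertices : 'M[int]_(d, d.+1);
  bary : 'M[int]_(d.+1, d);
  offset : 'cV[int]_d.+1;
  scale : nat;
  scale_gt0 : (0 < scale)%N;
  bary_vertices : forall i j, (bary *m vertices) i j + offset i 0 = (scale%:Z) *+ (i == j);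
  bary_cancel : forall a : 'cV[int]_d, \sum_i (bary *m a) i 0 = 0;
  bary_combine : vertices *m bary = (scale%:Z)%:M }.

Section Simplex.
Variables (d : nat) (T : lattice_simplex d).
Implicit Types (a b : 'cV[int]_d) (i j k : 'I_d.+1) (J K : {set 'I_d.+1}).

Definition lin a i : int := (bary T *m a) i 0.
Definition aff a i : int := lin a i + offset T i 0.
Definition vtx j : 'cV[int]_d := col j (vertices T).

Lemma lin0 i : lin 0 i = 0.
Proof. by rewrite /lin mulmx0 mxE. Qed.
Lemma linD a b i : lin (a + b) i = lin a i + lin b i.
Proof. by rewrite /lin mulmxDr mxE. Qed.
Lemma linN a i : lin (- a) i = - lin a i.
Proof. by rewrite /lin mulmxN mxE. Qed.
Lemma linZ c a i : lin (c *: a) i = c * lin a i.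
Proof. by rewrite /lin -scalemxAr mxE. Qed.
Lemma lin_sumr (I : finType) (P : pred I) (h : I -> 'cV[int]_d) i :
  lin (\sum_(l | P l) h l) i = \sum_(l | P l) lin (h l) i.
Proof. by rewrite /lin mulmx_sumr summxE. Qed.

Lemma sum_lin a : \sum_i lin a i = 0.
Proof. exact: bary_cancel. Qed.

Lemma combine_lin a : \sum_i lin a i *: vtx i = (scale T)%:Z *: a.
Proof.
rewrite -mul_scalar_mx -bary_combine -mulmxA.
apply/colP => l; rewrite summxE [RHS]mxE; apply: eq_bigr => i _.
by rewrite mxE [vtx i l 0]mxE mulrC.
Qed.

Lemma aff_vtx i j : aff (vtx j) i = (scale T)%:Z *+ (i == j).
Proof.
rewrite -bary_vertices /aff /lin; congr (_ + _); rewrite !mxE.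
by apply: eq_bigr => l _; rewrite mxE.
Qed.

Lemma lin_edge i j k : lin (vtx j - vtx k) i = (scale T)%:Z *+ (i == j) - (scale T)%:Z *+ (i == k).
Proof. by rewrite linD linN -!aff_vtx /aff opprD addrACA subrr addr0. Qed.

Lemma sum_aff a : \sum_i aff a i = (scale T)%:Z.
Proof.
have so : \sum_i offset T i 0 = (scale T)%:Z.
  transitivity (\sum_i aff (vtx ord0) i).
    by rewrite /aff big_split /= sum_lin add0r.
  under eq_bigr do rewrite aff_vtx; rewrite (bigD1 ord0) //= big1 ?addr0 // => i /negbTE -> //.
by rewrite /aff big_split /= sum_lin add0r.
Qed.

Lemma combine_aff a : \sum_i aff a i *: vtx i = (scale T)%:Z *: a.
Proof.
have so : \sum_i offset T i 0 *: vtx i = 0.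
  have E : \sum_i aff (vtx ord0) i *: vtx i = (scale T)%:Z *: vtx ord0.
    under eq_bigr do rewrite aff_vtx; rewrite (bigD1 ord0) //= big1 ?addr0 // => i /negbTE ->.
    by rewrite scale0r.
  move: E; under eq_bigr do rewrite /aff scalerDl; rewrite big_split /= combine_lin.
  by rewrite -[RHS]addr0 => /addrI.
under eq_bigr do rewrite scalerDl.
by rewrite big_split /= combine_lin so addr0.
Qed.

(** A face is given by the set K of its vertices: it is cut out by the vanishing
    of the coordinates outside K. The integer vectors parallel to the face form
    face_lattice; the semigroup of the chart of J consists of those vectors
    that point into the simplex from the face J. *)
Definition face_lattice K a := [forall i, (i \notin K) ==> (lin a i == 0)].
Definition face_semigroup J a := [forall i, (i \notin J) ==> (0 <= lin a i)].

Lemma face_latticeP K a : reflect (forall i, i \notin K -> lin a i = 0) (face_lattice K a).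
Proof.
apply: (iffP forallP) => H i; first by move=> iK; apply/eqP; have /implyP := H i; exact.
by apply/implyP => iK; rewrite H.
Qed.

Lemma face_semigroupP J a : reflect (forall i, i \notin J -> 0 <= lin a i) (face_semigroup J a).
Proof.
by apply: (iffP forallP) => H i; [move=> iJ; have /implyP := H i; exact|apply/implyP/H].
Qed.

Lemma face_lattice0 K : face_lattice K 0.
Proof. by apply/face_latticeP => i _; rewrite lin0. Qed.
Lemma face_latticeD K a b : face_lattice K a -> face_lattice K b -> face_lattice K (a + b).
Proof.
move=> /face_latticeP ha /face_latticeP hb; apply/face_latticeP => i iK.
by rewrite linD ha // hb.
Qed.
Lemma face_latticeZ K c a : face_lattice K a -> face_lattice K (c *: a).
Proof.
by move=> /face_latticeP ha; apply/face_latticeP => i iK; rewrite linZ ha // mulr0.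
Qed.
Lemma face_semigroup0 J : face_semigroup J 0.
Proof. by apply/face_semigroupP => i _; rewrite lin0. Qed.
Lemma face_semigroupD J a b : face_semigroup J a -> face_semigroup J b -> face_semigroup J (a + b).
Proof.
move=> /face_semigroupP ha /face_semigroupP hb; apply/face_semigroupP => i iJ.
by rewrite linD addr_ge0 ?ha ?hb.
Qed.
Lemma face_semigroupMn J a l : face_semigroup J a -> face_semigroup J (a *+ l).
Proof.
move=> ha; elim: l => [|l IH]; first exact: face_semigroup0.
by rewrite mulrS face_semigroupD.
Qed.
Lemma face_semigroupS J J' a : J \subset J' -> face_semigroup J a -> face_semigroup J' a.
Proof.
move=> sJ /face_semigroupP ha; apply/face_semigroupP => i iJ; apply: ha.
by apply: contra iJ; apply/fintype.subsetP.
Qed.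

Section Projector.
Variable F : finFieldType.

Definition trivial_on (E : 'M[int]_d) : {set {ffun 'I_d -> F}} :=
  [set z in torus F d | [forall k, monom z (col k E) == 1]].

(** The face lattice of K is the kernel of the linear forms of index outside
    K. Its corank r is found by comparing traces: E and the rational projector
    E' / scale, which is built from the edges at a vertex j0 of K, have the same
    image, hence the same trace, and the trace of E' / scale is |K| - 1. *)
Lemma face_projector K : exists E : 'M[int]_d, K != finset.set0 ->
  [/\ forall a, face_lattice K (E *m a),
      forall a, face_lattice K a -> E *m a = a
    & #|trivial_on E| = (#|F|.-1 ^ (d.+1 - #|K|))%N ].
Proof.
pose A : 'M[int]_(d.+1, d) := \matrix_(i, j) if i \in K then 0 else bary T i j.
have AE a : A *m a = 0 <-> face_lattice K a.
  have Aa i : (A *m a) i 0 = if i \in K then 0 else lin a i.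
    rewrite mxE; case: ifP => iK; last by rewrite /lin mxE; apply: eq_bigr => j _; rewrite mxE iK.
    by apply: big1 => j _; rewrite mxE iK mul0r.
  split => [H|/face_latticeP H].
    by apply/face_latticeP => i /negbTE iK; have := Aa i; rewrite iK H mxE.
  by apply/colP => i; rewrite Aa mxE; case: (boolP (i \in K)) => // /H.
have [E [EA EI] [r trE cE]] := integer_kernel_projector F A.
exists E => K0; split; [by move=> a; apply/AE|by move=> a /AE; exact: EI|].
rewrite /trivial_on cE; congr (_ ^ _)%N.
have /finset.set0Pn[j0 j0K] := K0.
pose U : 'M[int]_(d, d.+1) := \matrix_(l, i) if i \in K then (vtx i - vtx j0) l 0 else 0.
pose E' := U *m bary T.
have E'E a : E' *m a = \sum_(i in K) lin a i *: (vtx i - vtx j0).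
  apply/colP => l; rewrite summxE -mulmxA mxE [RHS]big_mkcond; apply: eq_bigr => i _.
  by rewrite mxE; case: ifP => iK; rewrite ?mul0r // [RHS]mxE mulrC.
have E'K a : face_lattice K (E' *m a).
  apply/face_latticeP => i iK; rewrite E'E lin_sumr big1 // => j jK.
  rewrite linZ lin_edge.
  have -> : (i == j) = false by apply: contraNF iK => /eqP ->.
  have -> : (i == j0) = false by apply: contraNF iK => /eqP ->.
  by rewrite subrr mulr0.
have E'I a : face_lattice K a -> E' *m a = (scale T)%:Z *: a.
  move/face_latticeP => H; rewrite -combine_lin E'E.
  have S0 : \sum_(i in K) lin a i = 0.
    rewrite -[RHS](sum_lin a) [RHS](bigID (mem K)) /= [X in _ + X]big1 ?addr0 //.
  transitivity (\sum_(i in K) lin a i *: vtx i).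
    under eq_bigr do rewrite scalerBr.
    by rewrite big_split /= sumrN -scaler_suml S0 scale0r oppr0 addr0.
  rewrite [RHS](bigID (mem K)) /= [X in _ + X]big1 ?addr0 // => i iK.
  by rewrite H // scale0r.
have mx_ext (M M' : 'M[int]_d) : (forall a, M *m a = M' *m a) -> M = M'.
  move=> H; apply/matrixP => i j; have := congr1 (fun v : 'cV_d => v i 0) (H (delta_mx j 0)).
  by rewrite -!colE !mxE.
(* E and E' / scale are projectors with the same image. *)
have EE' : E *m E' = E'.
  by apply: mx_ext => a; rewrite -mulmxA EI //; apply/AE.
have E'E2 : E' *m E = (scale T)%:Z *: E.
  by apply: mx_ext => a; rewrite -mulmxA E'I ?scalemxAl //; apply/AE.
have : \tr E' = (scale T)%:Z * \tr E by rewrite -mxtraceZ -E'E2 [RHS]mxtrace_mulC EE'.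
have -> : \tr E' = (scale T)%:Z * (#|K|%:Z - 1).
  rewrite mxtrace_mulC /mxtrace.
  transitivity (\sum_(i in K) ((scale T)%:Z - (scale T)%:Z *+ (i == j0))).
    rewrite [RHS]big_mkcond; apply: eq_bigr => i _.
    transitivity (if i \in K then lin (vtx i - vtx j0) i else 0).
      rewrite mxE; case: ifP => iK; last by apply: big1 => l _; rewrite mxE iK mulr0.
      by rewrite /lin mxE; apply: eq_bigr => l _; rewrite [U _ _]mxE iK.
    by case: ifP => // _; rewrite lin_edge eqxx.
  rewrite sumrB sumr_const (bigD1 j0) //= eqxx big1 ?addr0 => [|i /andP[_ /negbTE ->] //].
  by rewrite mulrBr mulr1 -mulr_natr natz.
move/mulfI => /(_ _)/[!trE] H; have := H; have := scale_gt0 T.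
have : (#|K| <= d.+1)%N by rewrite -[X in (_ <= X)%N]card_ord max_card.
lia.
Qed.

End Projector.
End Simplex.

(** * Multiplicative functions on the semigroup of a face *)

Lemma additive_hom_monom (F : fieldType) d (h : 'cV[int]_d -> F) :
  h 0 = 1 -> (forall a b, h (a + b) = h a * h b) ->
  (forall a, h a != 0) /\ (forall a, h a = monom (fun k => h (delta_mx k 0)) a).
Proof.
move=> h0 hD; have hn a : h a != 0.
  by apply/eqP => E; have := hD a (- a); rewrite subrr h0 E mul0r => /eqP; rewrite oner_eq0.
split=> // a; have hZn v (l : nat) : h (v *+ l) = h v ^+ l.
  by elim: l => [|l IH]; rewrite ?mulr0n ?expr0 // mulrS hD IH exprS.
have hZ v (z : int) : h (z *: v) = h v ^ z.
  have zn l (w : 'cV[int]_d) : l%:Z *: w = w *+ l by rewrite -natz scaler_nat.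
  case: z => l; first by rewrite zn hZn.
  apply: (mulIf (hn (l.+1%:Z *: v))); rewrite -hD NegzE scaleNr addNr h0.
  by rewrite zn hZn -exprnN mulVf // expf_neq0.
rewrite {1}(matrix_sum_delta a) (big_morph h hD h0); apply: eq_bigr => i _.
by rewrite big_ord_recl big_ord0 addr0 hZ.
Qed.

Section AffinePoints.
Variables (F : finFieldType) (d : nat) (T : lattice_simplex d).
Implicit Types (a b : 'cV[int]_d) (i j k : 'I_d.+1) (J K : {set 'I_d.+1}).
Implicit Types (x : 'I_d -> F) (p : 'cV[int]_d -> F).

Definition monoid_point J p : Prop :=
  p 0 = 1 /\ forall a b, face_semigroup T J a -> face_semigroup T J b -> p (a + b) = p a * p b.

(** A point of the torus orbit of the face K, seen as a multiplicative function
    on the semigroup of any face J contained in K. *)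
Definition orbit_point K x a : F := if face_lattice T K a then monom x a else 0.

Lemma orbit_point_monoid J K x : J \subset K -> (forall l, x l != 0) ->
  monoid_point J (orbit_point K x).
Proof.
move=> JK x0; split; first by rewrite /orbit_point face_lattice0 monom0.
move=> a b /face_semigroupP ha /face_semigroupP hb; rewrite /orbit_point.
have -> : face_lattice T K (a + b) = face_lattice T K a && face_lattice T K b.
  apply/idP/andP => [/face_latticeP H|[]]; last exact: face_latticeD.
  suff P i : i \notin K -> lin T a i = 0 /\ lin T b i = 0.
    by split; apply/face_latticeP => i /P [].
  move=> iK; have iJ : i \notin J by apply: contra iK; apply/fintype.subsetP.
  by have := H i iK; rewrite linD; have := ha i iJ; have := hb i iJ; lia.
by case: (face_lattice T K a) (face_lattice T K b) => [] [] /=; rewrite ?mul0r ?mulr0 ?monomD.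
Qed.

Section Classification.
Variables (J : {set 'I_d.+1}) (p : 'cV[int]_d -> F) (j0 : 'I_d.+1).
Hypothesis pJ : monoid_point J p.
Hypothesis j0J : j0 \in J.

Let edge i := vtx T i - vtx T j0.

Let pD a b : face_semigroup T J a -> face_semigroup T J b -> p (a + b) = p a * p b.
Proof. by case: pJ => _; exact. Qed.

Let pMn a l : face_semigroup T J a -> p (a *+ l) = p a ^+ l.
Proof.
move=> ha; elim: l => [|l IH]; first by case: pJ.
by rewrite mulrS pD ?face_semigroupMn // IH exprS.
Qed.

Let p_sum (I : finType) (h : I -> 'cV[int]_d) : (forall l, face_semigroup T J (h l)) ->
  p (\sum_l h l) = \prod_l p (h l).
Proof.
move=> H; suff [] : face_semigroup T J (\sum_l h l) /\ p (\sum_l h l) = \prod_l p (h l) by [].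
elim/big_rec2: _ => [|l y z _ [hz IH]]; first by split; [exact: face_semigroup0|case: pJ].
by split; [apply: face_semigroupD|rewrite pD // IH].
Qed.

Let edge_semigroup i : face_semigroup T J (edge i).
Proof.
apply/face_semigroupP => k kJ; rewrite lin_edge.
have -> : (k == j0) = false by apply: contraNF kJ => /eqP ->.
by rewrite mulr0n subr0; case: eqP.
Qed.

Let edgeN_semigroup i : i \in J -> face_semigroup T J (- edge i).
Proof.
move=> iJ; apply/face_semigroupP => k kJ; rewrite linN lin_edge.
have -> : (k == j0) = false by apply: contraNF kJ => /eqP ->.
by have -> : (k == i) = false by apply: contraNF kJ => /eqP ->.
Qed.

(** The edge from j0 to i generates the semigroup in the direction of i, so the
    orbit of p is the face spanned by the edges at which p is not 0. *)
Let K := J :|: [set i | p (edge i) != 0].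

Let p_edge_neq0 i : i \in J -> p (edge i) != 0.
Proof.
move=> iJ; apply/eqP => E; have := pD (edge_semigroup i) (edgeN_semigroup iJ).
by rewrite subrr E mul0r; case: pJ => -> _ /eqP; rewrite oner_eq0.
Qed.

Let in_K i : (i \in K) = (p (edge i) != 0).
Proof. by rewrite !inE; case: (boolP (i \in J)) => //= /p_edge_neq0 ->. Qed.

(** A multiple of a is the sum of the edges with multiplicities |lin a i|, where
    an edge inside J is reversed when lin a i < 0. So a power of p a is the
    product of the values of p at these edges. *)
Let support_K a : face_semigroup T J a -> (p a != 0) = face_lattice T K a.
Proof.
move=> ha; have /face_semigroupP hP := ha.
pose sedge i := if 0 <= lin T a i then edge i else - edge i.
have sJ i : face_semigroup T J (sedge i).
  rewrite /sedge; case: ifP => // /negbT neg; apply: edgeN_semigroup.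
  by apply: contraR neg => /hP.
have decomp : a *+ scale T = \sum_i sedge i *+ `|lin T a i|%N.
  rewrite -scaler_nat natz -combine_lin.
  have -> : \sum_i lin T a i *: vtx T i = \sum_i lin T a i *: edge i.
    under [RHS]eq_bigr do rewrite scalerBr.
    by rewrite big_split /= sumrN -scaler_suml sum_lin scale0r oppr0 addr0.
  apply: eq_bigr => i _; rewrite /sedge -scaler_nat natz; case: ifP => h.
    by rewrite gez0_abs.
  by rewrite scalerN -scaleNr; congr (_ *: _); lia.
have pa : p a ^+ scale T = \prod_i p (sedge i) ^+ `|lin T a i|%N.
  rewrite -pMn // decomp p_sum => [|i]; last exact: face_semigroupMn.
  by apply: eq_bigr => i _; rewrite pMn.
have -> : (p a != 0) = (p a ^+ scale T != 0) by rewrite expf_eq0 scale_gt0.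
rewrite pa; apply/prodf_neq0/face_latticeP => H i; last first.
  move=> _; have [iK|iK] := boolP (i \in K); last by rewrite H // expr0 oner_eq0.
  apply: expf_neq0; rewrite /sedge; case: ifP => h; first by rewrite -in_K.
  have iJ : i \in J by apply: contraFT h => /hP.
  apply/eqP => E; have := pD (edge_semigroup i) (edgeN_semigroup iJ).
  by rewrite subrr E mulr0; case: pJ => -> _ /eqP; rewrite oner_eq0.
move=> iK; have := H i isT; rewrite expf_eq0 negb_and -leqNgt leqn0 absz_eq0.
case/orP => [/eqP //|]; rewrite /sedge hP; last by apply: contra iK; rewrite inE => ->.
by rewrite -in_K (negbTE iK).
Qed.

(** Adding a large multiple of this vector moves any vector of the face lattice
    of K into the semigroup of J. *)
Let interior : 'cV[int]_d := \sum_(i in K) edge i.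

Let lin_interior k : lin T interior k =
  (scale T)%:Z *+ (k \in K) - (scale T)%:Z *+ (#|K| * (k == j0)).
Proof.
rewrite lin_sumr; under eq_bigr do rewrite lin_edge.
rewrite sumrB sumr_const -mulrnA mulnC; congr (_ - _).
case: (boolP (k \in K)) => kK; last first.
  by apply: big1 => i iK; case: eqP => // E; rewrite E iK in kK.
by rewrite (bigD1 k) //= eqxx big1 ?addr0 // => i /andP[_]; rewrite eq_sym => /negbTE ->.
Qed.

Let j0K : j0 \in K.
Proof. by rewrite inE j0J. Qed.

Let interior_face : face_lattice T K interior.
Proof.
apply/face_latticeP => k kK; rewrite lin_interior (negbTE kK).
have -> : (k == j0) = false by apply: contraNF kK => /eqP ->.
by rewrite muln0 !mulr0n subr0.
Qed.

Let large a (l : nat) : face_lattice T K a -> (\sum_k `|lin T a k| <= l)%N ->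
  face_semigroup T J (a + interior *+ l).
Proof.
move=> /face_latticeP aK al; apply/face_semigroupP => k kJ.
rewrite linD -scaler_nat natz linZ lin_interior.
have -> : (k == j0) = false by apply: contraNF kJ => /eqP ->.
rewrite muln0 mulr0n subr0; case: (boolP (k \in K)) => kK; last by rewrite aK // mulr0.
have : (`|lin T a k| <= l)%N by apply: leq_trans al; rewrite (bigD1 k) //= leq_addr.
have s1 : (1 : int) <= (scale T)%:Z by have := scale_gt0 T; lia.
have : l%:Z <= l%:Z * (scale T)%:Z by rewrite ler_peMr.
by rewrite mulr1n; lia.
Qed.

Let interior_semigroup l : face_semigroup T J (interior *+ l).
Proof.
rewrite -[_ *+ _]add0r; apply: large; first exact: face_lattice0.
by rewrite big1 // => k _; rewrite lin0.
Qed.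

Let p_interior_neq0 l : p (interior *+ l) != 0.
Proof. by rewrite support_K // -scaler_nat natz face_latticeZ. Qed.

Let bound a := (\sum_k `|lin T a k|)%N.
(** The extension of p from the semigroup to the face lattice, as a group of
    differences. The multiple of interior only has to be large
    [phiE]. *)
Let phi a := p (a + interior *+ bound a) / p (interior *+ bound a).

Let phiE a l : face_lattice T K a -> (bound a <= l)%N ->
  phi a = p (a + interior *+ l) / p (interior *+ l).
Proof.
move=> aK al; apply/eqP; rewrite eqr_div //; apply/eqP.
by rewrite -!pD ?large // addrAC.
Qed.

Let phi_semigroup a : face_semigroup T J a -> face_lattice T K a -> phi a = p a.
Proof. by move=> aJ aK; rewrite /phi pD // mulfK. Qed.

Let phiD a b : face_lattice T K a -> face_lattice T K b -> phi (a + b) = phi a * phi b.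
Proof.
move=> aK bK; (* A common multiple of interior for the three values. *)
pose l := (bound a + bound b + bound (a + b))%N.
have [al bl abl] : [/\ (bound a <= l)%N, (bound b <= l)%N & (bound (a + b) <= l)%N].
  by rewrite /l; split; lia.
rewrite (@phiE a l) // (@phiE b l) // (@phiE (a + b) l) ?face_latticeD //.
apply/eqP; rewrite mulf_div eqr_div ?mulf_neq0 //; apply/eqP.
have [aS bS abS] : [/\ face_semigroup T J (a + interior *+ l),
    face_semigroup T J (b + interior *+ l) & face_semigroup T J (a + b + interior *+ l)].
  by split; rewrite large ?face_latticeD.
have iS : face_semigroup T J (interior *+ l + interior *+ l) by rewrite -mulrnDr.
have abS' := face_semigroupD aS bS.
rewrite -!pD //; congr p.
by rewrite (addrACA a) -!addrA.
Qed.

Let phi_neq0 a : face_lattice T K a -> phi a != 0.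
Proof.
move=> aK; rewrite mulf_neq0 ?invr_eq0 // support_K ?large // .
by rewrite face_latticeD // -scaler_nat natz face_latticeZ.
Qed.

(** The homomorphism phi extends to Z^d through the projector of the face
    lattice. The coordinates of its monomial form are then fixed by the
    projector, which selects one representative x for each point of the
    orbit. *)
Lemma monoid_point_orbit (E : {set 'I_d.+1} -> 'M[int]_d) :
  (forall L : {set 'I_d.+1}, L != finset.set0 ->
     (forall a, face_lattice T L (E L *m a)) /\
     (forall a, face_lattice T L a -> E L *m a = a)) ->
  exists (L : {set 'I_d.+1}) (x : {ffun 'I_d -> F}), [/\ J \subset L, x \in torus F d,
    forall l, x l = monom x (col l (E L)) &
    forall a, face_semigroup T J a -> p a = orbit_point L x a].
Proof.
move=> EP; have K0 : K != finset.set0 by apply/finset.set0Pn; exists j0.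
have [EK EI] := EP K K0; exists K.
pose h a := phi (E K *m a).
have h0 : h 0 = 1.
  have : h (0 + 0) = h 0 * h 0 by rewrite /h mulmxDr phiD.
  have := phi_neq0 (EK 0); rewrite addr0 -/(h 0) => h0 /eqP.
  by rewrite -{1}[h 0]mulr1 (inj_eq (mulfI h0)) eq_sym => /eqP.
have [hn hE] := additive_hom_monom h0 (fun a b =>
  etrans (congr1 phi (mulmxDr _ a b)) (phiD (EK a) (EK b))).
pose x : {ffun 'I_d -> F} := [ffun l => h (delta_mx l 0)].
have xE a : monom x a = h a by rewrite hE; apply: monom_ext => k; rewrite ffunE.
exists x; split.
- exact: finset.subsetUl.
- by apply/torusP => k; rewrite ffunE.
- by move=> k; rewrite xE ffunE /h colE (EI (_ *m _)).
move=> a aJ; rewrite /orbit_point; case: (boolP (face_lattice T K a)) => aK.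
  by rewrite xE /h EI // phi_semigroup.
by apply/eqP/negPn; rewrite support_K.
Qed.

End Classification.

(** The support of the function recovers K, by evaluation at the edges issued
    from j0. The vectors of the semigroup generate the face lattice of K, as
    a = (a + l w) - l w for w interior to the face and l large. *)
Lemma orbit_point_inj J K (L : {set 'I_d.+1}) x y j0 : j0 \in J -> J \subset K -> J \subset L ->
  (forall l, x l != 0) -> (forall l, y l != 0) ->
  (forall a, face_semigroup T J a -> orbit_point K x a = orbit_point L y a) ->
  K = L /\ (forall a, face_lattice T K a -> monom x a = monom y a).
Proof.
move=> j0J JK JL x0 y0 H.
have edgeJ i : face_semigroup T J (vtx T i - vtx T j0).
  apply/face_semigroupP => k kJ; rewrite lin_edge.
  have -> : (k == j0) = false by apply: contraNF kJ => /eqP ->.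
  by rewrite mulr0n subr0; case: eqP.
have edge_face (M : {set 'I_d.+1}) i : J \subset M ->
    face_lattice T M (vtx T i - vtx T j0) = (i \in M).
  move=> /fintype.subsetP JM; apply/face_latticeP/idP => [Hk|iM k kM].
    apply: contraT => iM; have := Hk i iM; rewrite lin_edge eqxx.
    have -> : (i == j0) = false by apply: contraNF iM => /eqP ->; apply: JM.
    by have := scale_gt0 T; rewrite mulr0n mulr1n; lia.
  rewrite lin_edge.
  have -> : (k == j0) = false by apply: contraNF kM => /eqP ->; apply: JM.
  by have -> : (k == i) = false by apply: contraNF kM => /eqP ->.
have supp (M : {set 'I_d.+1}) z a : (forall l, z l != 0) ->
    (orbit_point M z a != 0) = face_lattice T M a.
  by move=> z0; rewrite /orbit_point; case: ifP; rewrite ?eqxx // monom_neq0.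
have KL : K = L.
  apply/setP => i; rewrite -(edge_face K) // -(edge_face L) //.
  by rewrite -(supp K x) // -(supp L y) // H.
split=> // a aK; pose w := \sum_(i in K) (vtx T i - vtx T j0).
have wK : face_lattice T K w.
  rewrite /w; elim/big_ind: _ => [|? ?|i iK]; first exact: face_lattice0.
    exact: face_latticeD.
  by rewrite edge_face.
have wl k : k \in K -> k != j0 -> lin T w k = (scale T)%:Z.
  move=> kK kj; rewrite lin_sumr (bigD1 k) //= lin_edge eqxx (negbTE kj) subr0.
  rewrite big1 ?addr0 // => i /andP[_ ik]; rewrite lin_edge eq_sym (negbTE ik) (negbTE kj) //.
pose l := (\sum_k `|lin T a k|)%N.
have face_J b : face_lattice T K b ->
    (forall k, k \in K -> k != j0 -> 0 <= lin T b k) -> face_semigroup T J b.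
  move=> /face_latticeP bK bk; apply/face_semigroupP => k kJ.
  have [kK|kK] := boolP (k \in K); last by rewrite bK.
  by apply: bk => //; apply: contraNneq kJ => ->.
have wlK : face_lattice T K (w *+ l) by rewrite -scaler_nat natz face_latticeZ.
have e1 : monom x (w *+ l) = monom y (w *+ l).
  have := H (w *+ l); rewrite /orbit_point -KL wlK; apply; apply: face_J => // k kK kj.
  by rewrite -scaler_nat natz linZ wl // mulr_ge0.
have awK : face_lattice T K (a + w *+ l) by apply: face_latticeD.
have : monom x (a + w *+ l) = monom y (a + w *+ l).
  have := H (a + w *+ l); rewrite /orbit_point -KL awK; apply; apply: face_J => // k kK kj.
  rewrite linD -scaler_nat natz linZ wl //.
  have : (`|lin T a k| <= l)%N by rewrite /l (bigD1 k) //= leq_addr.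
  have s1 : (1 : int) <= (scale T)%:Z by have := scale_gt0 T; lia.
  have : l%:Z <= l%:Z * (scale T)%:Z by rewrite ler_peMr.
  by lia.
rewrite !monomD // e1 => /mulIf; apply; exact: monom_neq0.
Qed.

End AffinePoints.

(** * The normal fan of a simplex *)

Section NormalFanOfSimplex.
Local Open Scope classical_set_scope.
Local Open Scope ring_scope.
Variables (R : realType) (F : fieldType) (d : nat) (T : lattice_simplex d) (f : laurent F d).
Implicit Types (v x y : 'cV[R]_d) (i j k : 'I_d.+1) (J K : {set 'I_d.+1}).
Hypothesis vtx_supp : forall j, vtx T j \in finsupp f.
Hypothesis supp_simplex : forall e, e \in finsupp f -> forall i, 0 <= aff T e i.

Local Notation P := (newton_polytope R f).
Local Notation rvtx j := (to_real R (vtx T j)).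

Lemma pairingDl x y v : pairing (x + y) v = pairing x v + pairing y v.
Proof. by rewrite /pairing -big_split; apply: eq_bigr => i _; rewrite mxE mulrDl. Qed.
Lemma pairingZl c x v : pairing (c *: x) v = c * pairing x v.
Proof. by rewrite /pairing mulr_sumr; apply: eq_bigr => i _; rewrite mxE mulrA. Qed.
Lemma pairing0l v : pairing 0 v = 0.
Proof. by rewrite /pairing big1 // => i _; rewrite mxE mul0r. Qed.
Lemma pairing_suml (I : Type) (r : seq I) (Q : pred I) (h : I -> 'cV[R]_d) v :
  pairing (\sum_(l <- r | Q l) h l) v = \sum_(l <- r | Q l) pairing (h l) v.
Proof. exact: (big_morph (fun x => pairing x v) (fun a b => pairingDl a b v) (pairing0l v)). Qed.
Lemma pairingC x v : pairing x v = pairing v x.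
Proof. by apply: eq_bigr => i _; rewrite mulrC. Qed.

Lemma to_real_sum (I : finType) (h : I -> 'cV[int]_d) :
  to_real R (\sum_i h i) = \sum_i to_real R (h i).
Proof. by rewrite /to_real raddf_sum. Qed.

Lemma to_realZ c (a : 'cV[int]_d) : to_real R (c *: a) = c%:~R *: to_real R a.
Proof. by apply/colP => l; rewrite !mxE intrM. Qed.

Let scaleR_gt0 : (0 : R) < (scale T)%:R.
Proof. by rewrite ltr0n scale_gt0. Qed.

Lemma pairing_barycentric (a : 'cV[int]_d) v :
  (scale T)%:R * pairing (to_real R a) v = \sum_i (aff T a i)%:~R * pairing (rvtx i) v.
Proof.
rewrite -pairingZl -[(scale T)%:R]/((scale T)%:Z%:~R) -to_realZ -combine_aff to_real_sum.
by rewrite pairing_suml; apply: eq_bigr => i _; rewrite to_realZ pairingZl.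
Qed.

(** The barycentric coordinates of the exponents are nonnegative, so a linear
    form is minimal on the polytope at a vertex. *)
Lemma polytope_ge v c x : (forall i, c <= pairing (rvtx i) v) -> P x -> c <= pairing x v.
Proof.
move=> cv [w [w0 w1 ->]]; rewrite pairing_suml.
rewrite -[c]mul1r -w1 mulr_suml; rewrite big_seq [leRHS]big_seq.
apply: ler_sum => e ef; rewrite pairingZl ler_wpM2l //.
rewrite -(ler_pM2l scaleR_gt0) pairing_barycentric.
rewrite -[(scale T)%:R]/((scale T)%:Z%:~R) -(sum_aff T e) rmorph_sum mulr_suml.
by apply: ler_sum => i _; rewrite ler_wpM2l // ler0z supp_simplex.
Qed.

Lemma vtx_polytope j : P (rvtx j).
Proof.
exists (fun e => (e == vtx T j)%:R); split => [e||]; first by rewrite ler0n.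
  rewrite (bigD1_seq (vtx T j)) ?fset_uniq //= eqxx big1 ?addr0 // => e /negbTE -> //.
rewrite (bigD1_seq (vtx T j)) ?fset_uniq //= eqxx scale1r big1 ?addr0 // => e /negbTE ->.
by rewrite scale0r.
Qed.

Definition cone_of J : set 'cV[R]_d :=
  [set v | forall j, j \in J -> forall i, pairing (rvtx j) v <= pairing (rvtx i) v].

Definition minimizers v : {set 'I_d.+1} :=
  [set j : 'I_d.+1 | [forall i, pairing (rvtx j) v <= pairing (rvtx i) v]]%SET.

Let face v : set 'cV[R]_d :=
  [set x | P x /\ forall y, P y -> pairing x v <= pairing y v].

Lemma minimizersP v j :
  reflect (forall i, pairing (rvtx j) v <= pairing (rvtx i) v) (j \in minimizers v).
Proof. by rewrite inE; exact: forallP. Qed.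

Lemma minimizers_neq0 v : minimizers v != finset.set0.
Proof.
apply/finset.set0Pn; exists [arg min_(i < ord0) pairing (rvtx i) v]%O.
by apply/minimizersP => i; case: arg_minP => // j _; apply.
Qed.

Lemma vtx_face v j : j \in minimizers v -> face v (rvtx j).
Proof.
move=> /minimizersP H; split; first exact: vtx_polytope.
by move=> y; apply: polytope_ge.
Qed.

(** Minimality of v' on the face of v can be tested at the vertices of this
    face. If x lies on the face and v' is minimal at these vertices, then for N
    large N v - v' is also minimal at them, hence v' is not larger at x than at
    the vertices. *)
Lemma normal_cone_face v : normal_cone P (face v) = cone_of (minimizers v).
Proof.
apply/seteqP; split => v' /= H.
  by move=> j jJ i; apply: H; [exact: vtx_face|exact: vtx_polytope].
move=> x y [Px xmin] Py; have /finset.set0Pn[j0 j0J] := minimizers_neq0 v.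
have /minimizersP j0min := j0J.
set c0 := pairing (rvtx j0) v; set c := pairing (rvtx j0) v'.
have xc0 : pairing x v <= c0 by apply: xmin; exact: vtx_polytope.
suff xc : pairing x v' <= c.
  by apply: (le_trans xc); apply: polytope_ge Py; apply: H.
pose gap i := pairing (rvtx i) v - c0; pose gap' i := pairing (rvtx i) v' - c.
have gap_ge0 i : 0 <= gap i by rewrite subr_ge0.
(* With this N, the gap of N v - v' is nonnegative at each vertex; at the
   minimizers of v the gap is zero and H applies. *)
pose N := \sum_i `|gap' i / gap i|.
have N0 : 0 <= N by rewrite sumr_ge0.
have pNE z : pairing z (N *: v - v') = N * pairing z v - pairing z v'.
  rewrite pairingC pairingDl pairingZl -scaleN1r pairingZl mulN1r.
  by rewrite -!(pairingC z).
have : N * c0 - c <= pairing x (N *: v - v').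
  apply: polytope_ge Px => i; rewrite pNE.
  suff : gap' i <= N * gap i by rewrite /gap /gap'; lra.
  have [g0|gn] := eqVneq (gap i) 0.
    have iJ : i \in minimizers v.
      by apply/minimizersP => k; move: g0 (gap_ge0 k); rewrite /gap; lra.
    by rewrite g0 mulr0 /gap' subr_le0; apply: H.
  have gp : 0 < gap i by rewrite lt_neqAle eq_sym gn gap_ge0.
  rewrite -ler_pdivrMr // (le_trans (ler_norm _)) // /N (bigD1 i) //=.
  by rewrite lerDl sumr_ge0.
by rewrite pNE; have : N * pairing x v <= N * c0 by [apply: ler_wpM2l]; lra.
Qed.

(** The primitive normals up to scaling: the rays of the fan are spanned by the
    barycentric linear forms. *)
Let bary_row i : 'cV[R]_d := \col_l (bary T i l)%:~R.

Lemma pairing_bary_row (a : 'cV[int]_d) i : pairing (to_real R a) (bary_row i) = (lin T a i)%:~R.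
Proof.
rewrite /lin mxE rmorph_sum; apply: eq_bigr => l _.
by rewrite !mxE rmorphM mulrC.
Qed.

Lemma pairing_vtx_bary_row i j :
  pairing (rvtx j) (bary_row i) = (scale T)%:R *+ (i == j) - (offset T i 0)%:~R.
Proof.
rewrite pairing_bary_row; have := aff_vtx T i j; rewrite /aff => /(canRL (addrK _)) ->.
by rewrite rmorphB rmorphMn.
Qed.

Lemma bary_row_cone J i : i \notin J -> cone_of J (bary_row i).
Proof.
move=> iJ j jJ k; rewrite !pairing_vtx_bary_row lerD2r.
have -> : (i == j) = false by apply: contraNF iJ => /eqP ->.
by rewrite mulr0n mulrn_wge0 // ler0n.
Qed.

Lemma minimizers_surj J : J != finset.set0 -> exists v, minimizers v = J.
Proof.
move=> /finset.set0Pn[j0 j0J]; exists (\sum_(i | i \notin J) bary_row i).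
set v := \sum_(i | _) _.
have E j : pairing (rvtx j) v =
    (scale T)%:R *+ (j \notin J) - \sum_(i | i \notin J) (offset T i 0)%:~R.
  rewrite pairingC pairing_suml; under eq_bigr do rewrite pairingC pairing_vtx_bary_row.
  rewrite sumrB; congr (_ - _); case: (boolP (j \in J)) => jJ /=.
    by apply: big1 => i iJ; case: eqP => // ij; rewrite ij jJ in iJ.
  by rewrite (bigD1 j) //= eqxx big1 ?addr0 // => i /andP[_ /negbTE ->].
apply/setP => j; apply/minimizersP/idP => [H|jJ i]; last first.
  by rewrite !E jJ lerD2r mulr0n mulrn_wge0 // ler0n.
apply: contraT => jJ; have := H j0; rewrite !E j0J jJ lerD2r /= mulr1n mulr0n.
by rewrite leNgt scaleR_gt0.
Qed.

Lemma normal_fan_simplex :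
  normal_fan P = [set cone_of J | J in [set J | J != finset.set0]].
Proof.
apply/seteqP; split => s /=.
  move=> [G [_ [v ->]] <-]; exists (minimizers v); first exact: minimizers_neq0.
  by rewrite -normal_cone_face.
move=> [J J0 <-]; have [v vJ] := minimizers_surj J0.
exists (face v); last by rewrite -/(face v) normal_cone_face vJ.
split; last by exists v.
by have /finset.set0Pn[j jJ] := J0; exists (rvtx j); apply: vtx_face; rewrite vJ.
Qed.

(** The cone of J contains the barycentric forms of index outside J. Conversely
    scale * a is a combination of the edges issued from a vertex of J, with the
    coefficients lin a i, and a form of the cone of J is nonnegative on them,
    and zero on the edges inside J. *)
Lemma cone_semigroup_simplex J a : J != finset.set0 ->
  cone_semigroup (cone_of J) a <-> face_semigroup T J a.
Proof.
move=> /finset.set0Pn[j0 j0J]; split => [H|/face_semigroupP H].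
  apply/face_semigroupP => i iJ; have := H _ (bary_row_cone iJ).
  by rewrite pairing_bary_row ler0z.
move=> v vJ; rewrite -(pmulr_rge0 _ scaleR_gt0).
rewrite -pairingZl -[(scale T)%:R]/((scale T)%:Z%:~R) -to_realZ -combine_lin to_real_sum.
have -> : pairing (\sum_i to_real R (lin T a i *: vtx T i)) v =
   \sum_i (lin T a i)%:~R * (pairing (rvtx i) v - pairing (rvtx j0) v).
  rewrite pairing_suml; under [RHS]eq_bigr do rewrite mulrBr.
  rewrite sumrB -mulr_suml -rmorph_sum sum_lin mul0r subr0.
  by apply: eq_bigr => i _; rewrite to_realZ pairingZl.
apply: sumr_ge0 => i _; have [iJ|iJ] := boolP (i \in J); last first.
  by rewrite mulr_ge0 ?ler0z ?H // subr_ge0 vJ.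
suff -> : pairing (rvtx i) v = pairing (rvtx j0) v by rewrite subrr mulr0.
by apply/eqP; rewrite eq_le !vJ.
Qed.

Lemma cone_ofI J K : cone_of J `&` cone_of K = cone_of (J :|: K).
Proof.
apply/seteqP; split => v /=.
  by move=> [vJ vK] j; rewrite inE => /orP[]; [exact: vJ|exact: vK].
by move=> H; split => j jJ; apply: H; rewrite inE jJ ?orbT.
Qed.

End NormalFanOfSimplex.

(** * Laurent polynomials *)

Section ExtremalPair.
Variable V : zmodType.
Implicit Types (A B : seq V) (w : V -> int).

Lemma seq_minimum (X : eqType) (A : seq X) (w : X -> int) x0 : x0 \in A ->
  exists2 a, a \in A & forall a', a' \in A -> w a <= w a'.
Proof.
elim: A x0 => // y A IH x0 _; case: A IH => [|z A] IH.
  by exists y; rewrite ?inE // => a'; rewrite inE => /eqP ->.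
have [|a aA amin] := IH z; first by rewrite inE eqxx.
have [ya|ya] := lerP (w y) (w a).
  exists y; rewrite ?inE ?eqxx // => a'; rewrite inE => /orP[/eqP -> //|/amin].
  exact: le_trans.
exists a; first by rewrite inE aA orbT.
by move=> a'; rewrite inE => /orP[/eqP ->|/amin //]; exact: ltW.
Qed.

(** Replacing A and B by the minimizers of one additive function keeps every
    decomposition of a sum a + b, since a sum of two minima can only be
    decomposed into minima. Iterate over the functions. *)
Lemma extremal_pair_separating (ws : seq (V -> int)) A B a0 b0 :
  (forall w, List.In w ws -> {morph w : x y / x + y}) ->
  a0 \in A -> b0 \in B ->
  exists a b, [/\ a \in A, b \in B,
    (if ws is w :: _ then
      (forall a', a' \in A -> w a <= w a') /\ (forall b', b' \in B -> w b <= w b') else True) &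
    forall a' b', a' \in A -> b' \in B -> a' + b' = a + b ->
      forall w, List.In w ws -> w a' = w a].
Proof.
elim: ws A B a0 b0 => [|w ws IH] A B a0 b0 wD a0A b0B; first by exists a0, b0; split.
have wDw : {morph w : x y / x + y} by apply: wD; left.
have [a1 a1A a1min] := seq_minimum w a0A.
have [b1 b1B b1min] := seq_minimum w b0B.
have [|||a [b [aA bB _ H]]] := IH [seq a <- A | w a == w a1] [seq b <- B | w b == w b1] a1 b1.
- by move=> w' w'in; apply: wD; right.
- by rewrite mem_filter eqxx.
- by rewrite mem_filter eqxx.
move: aA bB; rewrite !mem_filter => /andP[/eqP wa aA] /andP[/eqP wb bB].
exists a, b; split=> //; first by rewrite wa wb.
move=> a' b' a'A b'B E; have := congr1 w E; rewrite !wDw wa wb => wE.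
have [wa' wb'] : w a' = w a1 /\ w b' = w b1.
  by have := a1min a' a'A; have := b1min b' b'B; lia.
move=> w' /= [<-|w'in]; first by rewrite wa' wa.
by apply: (H a' b') => //; rewrite mem_filter ?wa' ?wb' eqxx.
Qed.
End ExtremalPair.

(** The extremal coefficient of a product of Laurent polynomials with supports
    A and B comes from a single pair of exponents: take minima for w first, and
    then for the coordinates, which separate points. *)
Lemma extremal_pair d (w : 'cV[int]_d -> int) (A B : seq 'cV[int]_d) a0 b0 :
  {morph w : x y / x + y} -> a0 \in A -> b0 \in B ->
  exists a b, [/\ a \in A, b \in B, forall a', a' \in A -> w a <= w a',
    forall b', b' \in B -> w b <= w b' &
    forall a' b', a' \in A -> b' \in B -> a' + b' = a + b -> a' = a].
Proof.
move=> wD a0A b0B.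
pose ws := w :: [seq (fun a : 'cV[int]_d => a i 0) | i <- enum 'I_d].
have wsD w' : List.In w' ws -> {morph w' : x y / x + y}.
  move=> /= [<- //|]; rewrite /ws /=; elim: (enum 'I_d) => //= i s IH [<-|//] x y.
  by rewrite mxE.
have [a [b [aA bB [amin bmin] H]]] := extremal_pair_separating wsD a0A b0B.
exists a, b; split=> // a' b' a'A b'B E; apply/colP => i.
apply: (H a' b' a'A b'B E (fun a => a i 0)); right.
have : i \in enum 'I_d by rewrite mem_enum.
by elim: (enum 'I_d) => //= j s IH; rewrite inE => /orP[/eqP ->|/IH]; [left|right].
Qed.

Section LaurentAlgebra.
Local Open Scope classical_set_scope.
Local Open Scope ring_scope.
Variables (F : fieldType) (d : nat).
Implicit Types (f g h : laurent F d).

Lemma laurent_mulE f g e :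
  laurent_mul f g e = \sum_(a <- finsupp f) f a * g (e - a).
Proof.
rewrite /laurent_mul fsfunE; case: ifPn => // ne.
rewrite big_seq big1 // => a af; rewrite (fsfun_dflt (f := g)) ?mulr0 //.
apply: contra ne => eg; apply/imfset2P; exists a => //; exists (e - a) => //.
by rewrite addrC subrK.
Qed.

Lemma laurent_evalE (p : 'cV[int]_d -> F) g (S : {fset 'cV[int]_d}) :
  {subset finsupp g <= S} -> laurent_eval p g = \sum_(e <- S) g e * p e.
Proof.
move=> gS; rewrite /laurent_eval; apply: big_fset_incl; first exact/fsubsetP.
by move=> e _ eg; rewrite fsfun_dflt ?mul0r.
Qed.

Lemma laurent_eval_mul (p : 'cV[int]_d -> F) f g :
  laurent_eval p (laurent_mul f g)
    = \sum_(a <- finsupp f) \sum_(b <- finsupp g) f a * g b * p (a + b).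
Proof.
pose S : {fset 'cV[int]_d} := [fset (a + b)%R | a in finsupp f, b in finsupp g]%fset.
rewrite (@laurent_evalE _ _ S); last first.
  move=> e; rewrite mem_finsupp; apply: contraR => eS.
  by rewrite /laurent_mul fsfunE (negbTE eS).
under eq_bigr do rewrite laurent_mulE mulr_suml.
rewrite exchange_big /= big_seq [RHS]big_seq; apply: eq_bigr => a af.
transitivity (\sum_(e <- [fset (a + b)%R | b in finsupp g]%fset) f a * g (e - a) * p e).
  apply/esym/big_fset_incl.
    apply/fsubsetP => e /imfsetP[b /= bg ->].
    by apply/imfset2P; exists a => //; exists b.
  move=> e _ ne; rewrite (fsfun_dflt (f := g)) ?mulr0 ?mul0r //.
  apply: contra ne => eg; apply/imfsetP; exists (e - a) => //.
  by rewrite addrC subrK.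
rewrite big_imfset /=; last by move=> b b' _ _ /addrI.
by apply: eq_bigr => b _; rewrite addrC addKr.
Qed.

End LaurentAlgebra.

(** * Points of the closure *)

Section ClosurePoints.
Local Open Scope classical_set_scope.
Local Open Scope ring_scope.
Variables (R : realType) (F : finFieldType) (d : nat) (T : lattice_simplex d) (f : laurent F d).
Implicit Types (a b e : 'cV[int]_d) (i j : 'I_d.+1) (J K L : {set 'I_d.+1}).
Hypothesis vtx_supp : forall j, vtx T j \in finsupp f.
Hypothesis supp_simplex : forall e, e \in finsupp f -> forall i, 0 <= aff T e i.

Local Notation P := (newton_polytope R f).
Local Notation point := (set 'cV[R]_d * ('cV[int]_d -> F))%type.
Local Notation Sigma := (normal_fan P).
Local Notation cone J := (@cone_of R d T J).

Definition face_part K (x : 'I_d -> F) : F :=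
  \sum_(e <- finsupp f | [forall i, (i \notin K) ==> (aff T e i == 0)]) f e * monom x e.

Let aff_vtx0 i j : i != j -> aff T (vtx T j) i = 0.
Proof. by move=> /negbTE ij; rewrite aff_vtx ij. Qed.

Let semigroup_of_cone J a : J != finset.set0 ->
  cone_semigroup (cone J) a -> face_semigroup T J a.
Proof. by move=> J0; case: (cone_semigroup_simplex R T a J0). Qed.

Let cone_of_semigroup J a : J != finset.set0 ->
  face_semigroup T J a -> cone_semigroup (cone J) a.
Proof. by move=> J0; case: (cone_semigroup_simplex R T a J0). Qed.

(** If f * x^(- vtx j0) vanishes at the point, where j0 is a vertex of J, then
    so does face_part, up to a nonzero monomial. Conversely let f * h have its
    exponents in the semigroup of J. The extremal coefficients for a
    barycentric form of index outside J multiply to a nonzero coefficient, so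
    the exponents of h are bounded below by minus the minimum of the form on
    the support of f. Hence the terms of f * h on the face lattice of K are the
    products of terms of f on the face K with terms of h on a parallel face,
    and the value is a multiple of face_part. *)
Lemma in_closure_orbit J K x (p : 'cV[int]_d -> F) j0 :
  j0 \in J -> J \subset K -> (forall l, x l != 0) ->
  (forall a, face_semigroup T J a -> p a = orbit_point T K x a) ->
  in_closure (principal_ideal f) (cone J, p) <-> face_part K x = 0.
Proof.
move=> j0J /fintype.subsetP JK x0 pE.
have J0 : J != finset.set0 by apply/finset.set0Pn; exists j0.
have neq_j0 i : i \notin J -> i != j0 by apply: contraNneq => ->.
have offE i : i \notin J -> lin T (vtx T j0) i = - offset T i 0.
  by move=> iJ; have := aff_vtx0 (neq_j0 i iJ); rewrite /aff; lia.
split => [|fK0].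
  pose h : laurent F d := [fsfun e in [fset - vtx T j0]%fset => (1 : F)].
  have hE e : h e = (e == - vtx T j0)%:R by rewrite fsfunE inE; case: eqP.
  have hsupp : finsupp h = [fset - vtx T j0]%fset.
    by apply/fsetP => e; rewrite mem_finsupp hE in_fset1; case: (e == _); rewrite ?eqxx ?oner_eq0.
  have edgeJ a : a \in finsupp f -> face_semigroup T J (a - vtx T j0).
    move=> af; apply/face_semigroupP => i iJ; rewrite linD linN offE // opprK.
    exact: supp_simplex.
  move=> /(_ (laurent_mul f h)) /= H.
  have : laurent_eval p (laurent_mul f h) = 0.
    apply: H; first by exists h.
    move=> e; rewrite mem_finsupp laurent_mulE => ge; apply: cone_of_semigroup => //.
    have [a af ha] : exists2 a, a \in finsupp f & e - a = - vtx T j0.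
      apply: contrapT => N; move/eqP: ge; apply.
      rewrite big_seq big1 // => a af; rewrite hE; case: eqP => [E|_]; last by rewrite mulr0.
      by case: N; exists a.
    have -> : e = a - vtx T j0 by rewrite -ha addrC subrK.
    exact: edgeJ.
  rewrite laurent_eval_mul hsupp.
  have -> : \sum_(a <- finsupp f) \sum_(b <- [fset - vtx T j0]%fset) f a * h b * p (a + b)
      = face_part K x * monom x (- vtx T j0).
    rewrite /face_part mulr_suml [RHS]big_mkcond /= big_seq [RHS]big_seq; apply: eq_bigr => a af.
    rewrite big_seq_fset1 hE eqxx mulr1 pE ?edgeJ // /orbit_point.
    have -> : face_lattice T K (a - vtx T j0) = [forall i, (i \notin K) ==> (aff T a i == 0)].
      apply: eq_forallb => i; case: (boolP (i \in K)) => //= iK.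
      have iJ : i \notin J by apply: contra iK => /JK.
      by rewrite linD linN offE // opprK.
    by case: ifP => _; rewrite ?mulr0 // monomD // mulrA.
  by move/eqP; rewrite mulf_eq0 (negbTE (monom_neq0 _ x0)) orbF => /eqP.
move=> g [h _ <-] supp_fh /=.
(* The minimum of lin on the support of f is - offset i, reached at j0. *)
have h_ge b i : b \in finsupp h -> i \notin J -> offset T i 0 <= lin T b i.
  move=> bh iJ.
  have [a1 [b1 [a1f b1h amin bmin uniq]]] :=
    extremal_pair (fun u v => linD T u v i) (vtx_supp j0) bh.
  apply: le_trans (bmin _ bh).
  have : a1 + b1 \in finsupp (laurent_mul f h).
    rewrite mem_finsupp laurent_mulE (bigD1_seq a1) ?fset_uniq //= big_seq_cond big1 ?addr0.
      by rewrite addrC addKr mulf_neq0 // -mem_finsupp.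
    move=> a /andP[af /eqP aa1]; rewrite (fsfun_dflt (f := h)) ?mulr0 //.
    by apply/negP => bh'; apply: aa1; apply: (uniq a _ af bh'); rewrite addrC subrK.
  move/supp_fh => /(semigroup_of_cone J0) /face_semigroupP /(_ i iJ).
  by rewrite linD; have := amin _ (vtx_supp j0); rewrite offE //; lia.
have ab_semigroup a b : a \in finsupp f -> b \in finsupp h -> face_semigroup T J (a + b).
  move=> af bh; apply/face_semigroupP => i iJ; rewrite linD.
  by have := supp_simplex af i; have := h_ge b i bh iJ; rewrite /aff; lia.
rewrite laurent_eval_mul.
transitivity (face_part K x * \sum_(b <- finsupp h |
    [forall i, (i \notin K) ==> (lin T b i == offset T i 0)]) h b * monom x b); last first.
  by rewrite fK0 mul0r.
rewrite /face_part mulr_suml [RHS]big_mkcond big_seq [RHS]big_seq; apply: eq_bigr => a af.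
rewrite mulr_sumr [in RHS]big_mkcond /=.
have -> : (if [forall i, (i \notin K) ==> (aff T a i == 0)] then
   \sum_(b <- finsupp h) (if [forall i, (i \notin K) ==> (lin T b i == offset T i 0)] then
      f a * monom x a * (h b * monom x b) else 0) else 0) =
  \sum_(b <- finsupp h) (if [forall i, (i \notin K) ==> (aff T a i == 0)] &&
     [forall i, (i \notin K) ==> (lin T b i == offset T i 0)] then
      f a * monom x a * (h b * monom x b) else 0).
  by case: ifP => //= _; rewrite big1.
rewrite big_seq [RHS]big_seq; apply: eq_bigr => b bh.
rewrite pE ?ab_semigroup // /orbit_point.
have -> : face_lattice T K (a + b) = [forall i, (i \notin K) ==> (aff T a i == 0)] &&
     [forall i, (i \notin K) ==> (lin T b i == offset T i 0)].
  apply/face_latticeP/andP => [H|[/forallP Ha /forallP Hb] i iK].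
    split; apply/forallP => i; apply/implyP => iK;
    have iJ : i \notin J by [apply: contra iK => /JK];
    have := H i iK; rewrite linD; have := supp_simplex af i; have := h_ge b i bh iJ;
    by rewrite /aff; lia.
  have := Ha i; have := Hb i; rewrite iK /= linD /aff; lia.
by case: ifP => _; rewrite ?mulr0 // monomD // mulrACA.
Qed.

Lemma affine_point_cone J (p : 'cV[int]_d -> F) : J != finset.set0 ->
  affine_point (cone J) p <-> monoid_point T J p.
Proof.
move=> J0; split => -[p0 pM]; split => // a b Ja Jb; apply: pM;
by [apply: cone_of_semigroup|apply: semigroup_of_cone].
Qed.

(** The point y of a chart J lies on the orbit K, and x is a lift of it to the
    torus. *)
Definition represents (y : point) K (x : 'I_d -> F) : Prop :=
  exists J, [/\ J != finset.set0, J \subset K, y.1 = cone J &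
    forall a, face_semigroup T J a -> y.2 a = orbit_point T K x a].

Variable E : {set 'I_d.+1} -> 'M[int]_d.
Hypothesis EP : forall K, K != finset.set0 ->
  (forall a, face_lattice T K (E K *m a)) /\ (forall a, face_lattice T K a -> E K *m a = a).

(** Lifts of a point of the orbit K to the torus differ on a complement of the
    face lattice; this selects the one which is trivial there. *)
Definition normalized K (x : {ffun 'I_d -> F}) := [forall l, x l == monom x (col l (E K))].

Lemma chart_point_represents (y : point) : chart_point Sigma y ->
  exists K (x : {ffun 'I_d -> F}),
    [/\ x \in torus F d, normalized K x, K != finset.set0 & represents y K x].
Proof.
case: y => s p [/=]; rewrite (normal_fan_simplex R vtx_supp supp_simplex).
move=> -[J /= J0 <-] /affine_point_cone - /(_ J0) pJ.
have /finset.set0Pn[j0 j0J] := J0.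
have [K [x [JK xT xn pE]]] := monoid_point_orbit pJ j0J EP.
exists K, x; split => //; first by apply/forallP => l; rewrite {1}xn.
  by apply/finset.set0Pn; exists j0; apply: (fintype.subsetP JK).
by exists J.
Qed.

Lemma represents_glued y y' K x : (forall l, x l != 0) ->
  represents y K x -> represents y' K x -> glued y y'.
Proof.
move=> x0 [J [J0 JK y1 y2]] [J' [J'0 J'K y1' y2']].
have U0 : J :|: J' != finset.set0.
  by have /finset.set0Pn[j jJ] := J0; apply/finset.set0Pn; exists j; rewrite inE jJ.
exists (orbit_point T K x); split.
- rewrite y1 y1' cone_ofI; apply/affine_point_cone => //; apply: orbit_point_monoid => //.
  by rewrite finset.subUset JK.
- by move=> a; rewrite y1 => /(semigroup_of_cone J0) /y2.
- by move=> a; rewrite y1' => /(semigroup_of_cone J'0) /y2'.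
Qed.

(** The gluing function is a point of the chart of J :|: J', and it has the same
    restriction as y to the semigroup of J and as y' to that of J'. *)
Lemma glued_represents y y' K x K' x' :
  (forall l, x l != 0) -> (forall l, x' l != 0) ->
  represents y K x -> represents y' K' x' -> glued y y' ->
  K = K' /\ forall a, face_lattice T K a -> monom x a = monom x' a.
Proof.
move=> x0 x'0 [J [J0 JK y1 y2]] [J' [J'0 J'K y1' y2']] [p [pA p1 p2]].
have /finset.set0Pn[j jJ] := J0; have /finset.set0Pn[j' jJ'] := J'0.
have U0 : J :|: J' != finset.set0 by apply/finset.set0Pn; exists j; rewrite inE jJ.
move: pA; rewrite y1 y1' cone_ofI => /(affine_point_cone _ U0) pA.
have jU : j \in J :|: J' by rewrite inE jJ.
have [L [z [UL /torusP z0 _ pE]]] := monoid_point_orbit pA jU EP.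
have [JL J'L] : J \subset L /\ J' \subset L by apply/andP; rewrite -finset.subUset.
have [KL KLm] : K = L /\ forall a, face_lattice T K a -> monom x a = monom z a.
  apply: (orbit_point_inj jJ JK JL x0 z0) => a aJ.
  rewrite -y2 // -p1 ?y1; last by apply: cone_of_semigroup.
  by apply: pE; apply: face_semigroupS aJ; apply: finset.subsetUl.
have [K'L K'Lm] : K' = L /\ forall a, face_lattice T K' a -> monom x' a = monom z a.
  apply: (orbit_point_inj jJ' J'K J'L x'0 z0) => a aJ.
  rewrite -y2' // -p2 ?y1'; last by apply: cone_of_semigroup.
  by apply: pE; apply: face_semigroupS aJ; apply: finset.subsetUr.
split; first by rewrite K'L.
by move=> a aK; rewrite KLm // K'Lm // K'L -KL.
Qed.

Lemma represents_eq y K x x' : (forall a, face_lattice T K a -> monom x a = monom x' a) ->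
  represents y K x -> represents y K x'.
Proof.
move=> xx' [J [J0 JK y1 y2]]; exists J; split=> // a aJ.
by rewrite y2 // /orbit_point; case: ifP => // /xx'.
Qed.

Lemma toric_point_eq y y' K x : (forall l, x l != 0) ->
  represents y K x -> represents y' K x -> toric_point Sigma y = toric_point Sigma y'.
Proof.
suff H z z' : (forall l, x l != 0) -> represents z K x -> represents z' K x ->
    toric_point Sigma z `<=` toric_point Sigma z'.
  by move=> x0 ry ry'; apply/seteqP; split; apply: H.
move=> x0 rz rz' w [wc gw]; split=> //.
have [K' [x' [/torusP x'0 _ _ rw]]] := chart_point_represents wc.
have [KK' agree] := glued_represents x0 x'0 rz rw gw.
rewrite -KK' in rw; apply: (represents_glued x0 rz').
by apply: (@represents_eq w K x' x _ rw) => a aK; rewrite agree.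
Qed.

Definition orbit_points K : {set {ffun 'I_d -> F}} :=
  [set x in torus F d | normalized K x & face_part K x == 0]%SET.

Let standard (z : {set 'I_d.+1} * {ffun 'I_d -> F}) : point := (cone z.1, orbit_point T z.1 z.2).

Let standard_represents K (x : {ffun 'I_d -> F}) : K != finset.set0 ->
  represents (standard (K, x)) K x.
Proof. by move=> K0; exists K; split. Qed.

Let standard_chart K (x : {ffun 'I_d -> F}) : K != finset.set0 -> x \in torus F d ->
  chart_point Sigma (standard (K, x)).
Proof.
move=> K0 /torusP x0; split.
  by rewrite (normal_fan_simplex R vtx_supp supp_simplex); exists K.
by apply/affine_point_cone => //; apply: orbit_point_monoid.
Qed.

(** Each point of the closure has one representative made of an orbit K and a
    normalized x, taken in the chart of K itself. *)
Theorem closure_points_card :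
  (closure_points Sigma (principal_ideal f)
     #= `I_(\sum_(K : {set 'I_d.+1} | K != finset.set0) #|orbit_points K|))%card.
Proof.
pose Z : {set {set 'I_d.+1} * {ffun 'I_d -> F}} :=
  [set z | (z.1 != finset.set0) && (z.2 \in orbit_points z.1)]%SET.
have -> : (\sum_(K : {set 'I_d.+1} | K != finset.set0) #|orbit_points K|)%N = #|Z|.
  transitivity (\sum_(K : {set 'I_d.+1} | K != finset.set0) \sum_(x in orbit_points K) 1)%N.
    by apply: eq_bigr => K _; rewrite sum1_card.
  by rewrite pair_big_dep /= -sum1_card; apply: eq_bigl => z; rewrite /Z !inE.
have ZP z : z \in Z ->
  [/\ z.1 != finset.set0, z.2 \in torus F d, normalized z.1 z.2 & face_part z.1 z.2 = 0].
  by rewrite /Z !inE => /andP[-> /andP[-> /andP[-> /eqP]]].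
pose Phi (l : 'I_#|Z|) := toric_point Sigma (standard (enum_val l)).
have -> : closure_points Sigma (principal_ideal f) = Phi @` [set: 'I_#|Z|].
  apply/seteqP; split => s /=.
    move=> [y [yc ycl] <-].
    have [K [x [xT xn K0 ry]]] := chart_point_represents yc.
    have /torusP x0 := xT.
    have zZ : (K, x) \in Z.
      rewrite !inE /= K0 xn /=; apply/andP; split; first by apply/forallP.
      case: (ry) => J [/finset.set0Pn[j jJ] JK y1 y2].
      by apply/eqP/(in_closure_orbit jJ JK x0 y2); move: ycl; rewrite -y1; case: (y).
    exists (enum_rank_in zZ (K, x)) => //; rewrite /Phi enum_rankK_in //.
    exact: (toric_point_eq x0 (standard_represents x K0) ry).
  move=> [l _ <-]; have [K0 xT xn fx] := ZP _ (enum_valP l).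
  exists (standard (enum_val l)) => //; split.
    by move: K0 xT; case: (enum_val l) => K x; apply: standard_chart.
  move: K0 xT fx; case: (enum_val l) => K x /= K0 /torusP x0 fx.
  have /finset.set0Pn[j jK] := K0.
  by apply/(in_closure_orbit (K := K) (x := x) jK).
apply: card_eq_trans (inj_card_eq _) _; last by rewrite card_eq_sym card_II.
move=> l l' _ _ E12; apply: enum_val_inj.
have [K0 xT xn fx] := ZP _ (enum_valP l).
have [K0' xT' xn' fx'] := ZP _ (enum_valP l').
have /torusP x0 := xT; have /torusP x0' := xT'.
have rl : represents (standard (enum_val l)) (enum_val l).1 (enum_val l).2.
  by move: K0; case: (enum_val l) => K x; apply: standard_represents.
have rl' : represents (standard (enum_val l')) (enum_val l').1 (enum_val l').2.
  by move: K0'; case: (enum_val l') => K x; apply: standard_represents.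
have : toric_point Sigma (standard (enum_val l')) (standard (enum_val l')).
  split; first by move: K0' xT'; case: (enum_val l') => K x; apply: standard_chart.
  exact: (represents_glued x0' rl' rl').
have := E12; rewrite /Phi => <- [_ gl].
have : (enum_val l).1 = (enum_val l').1 /\
    forall a, face_lattice T (enum_val l).1 a -> monom (enum_val l).2 a = monom (enum_val l').2 a.
  exact: (glued_represents x0 x0' rl rl' gl).
case; move: K0 xn xn'; case: (enum_val l) => K x; case: (enum_val l') => K' x' /=.
move=> K0 xn xn' KK' agree.
rewrite -KK' in xn' *; congr (_, _); apply/ffunP => k.
rewrite (eqP (forallP xn k)) (eqP (forallP xn' k)); apply: agree.
by rewrite colE; have [] := EP K0.
Qed.

End ClosurePoints.

(** * Lifting the points of an orbit to the torus *)

Section FibreCount.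
Variables (F : finFieldType) (d : nat) (T : lattice_simplex d) (f : laurent F d).
Variables (E : {set 'I_d.+1} -> 'M[int]_d) (K : {set 'I_d.+1}).
Hypothesis K0 : K != finset.set0.
Hypothesis E_lattice : forall a, face_lattice T K (E K *m a).
Hypothesis E_id : forall a, face_lattice T K a -> E K *m a = a.

Let norm (x : {ffun 'I_d -> F}) : {ffun 'I_d -> F} := [ffun l => monom x (col l (E K))].

Let normE x a : x \in torus F d -> monom (norm x) a = monom x (E K *m a).
Proof. by move=> /torusP x0; rewrite monom_mulmx //; apply: monom_ext => l; rewrite ffunE. Qed.

Let norm_torus x : x \in torus F d -> norm x \in torus F d.
Proof. by move=> /torusP x0; apply/torusP => l; rewrite ffunE monom_neq0. Qed.

Let col_lattice l : face_lattice T K (col l (E K)).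
Proof. by rewrite colE. Qed.

Let norm_normalized x : x \in torus F d -> normalized E K (norm x).
Proof.
move=> xT; apply/forallP => l; rewrite normE // E_id // ffunE //.
Qed.

Let face_part_norm x : x \in torus F d ->
  (face_part T f K (norm x) == 0) = (face_part T f K x == 0).
Proof.
move=> xT; have /torusP x0 := xT; have /torusP nx0 := norm_torus xT.
have /finset.set0Pn[j jK] := K0.
pose edge_sum (y : {ffun 'I_d -> F}) : F :=
  \sum_(e <- finsupp f | [forall i, (i \notin K) ==> (aff T e i == 0)])
     f e * monom y (e - vtx T j).
have H y : y \in torus F d -> (face_part T f K y == 0) = (edge_sum y == 0).
  move=> /torusP y0; have -> : face_part T f K y = edge_sum y * monom y (vtx T j).
    by rewrite /edge_sum mulr_suml; apply: eq_bigr => e _; rewrite -mulrA -monomD // subrK.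
  by rewrite mulf_eq0 (negbTE (monom_neq0 _ y0)) orbF.
rewrite (H _ (norm_torus xT)) (H _ xT); congr (_ == 0); apply: eq_bigr => e /forallP eK.
congr (_ * _); rewrite normE // E_id //; apply/face_latticeP => i iK.
have := eK i; rewrite iK linD linN /= => /eqP ei.
have ij : (i == j) = false by apply: contraNF iK => /eqP ->.
by have := aff_vtx T i j; rewrite ij mulr0n; move: ei; rewrite /aff; lia.
Qed.

(** The vanishing of face_part depends on the point of the orbit only, since the
    exponents of a face differ by vectors of the face lattice. The lifts of a
    point form a coset of the group trivial_on. *)
Lemma card_face_solutions :
  #|[set x in torus F d | face_part T f K x == 0]|
    = (#|orbit_points T f E K| * #|trivial_on F (E K)|)%N.
Proof.
rewrite -[LHS]sum1_card (partition_big norm (mem (orbit_points T f E K))) /=; last first.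
  move=> x /finset.setIdP[xT fx]; apply/finset.setIdP; split; first exact: norm_torus.
  by rewrite norm_normalized //= face_part_norm.
rewrite -sum_nat_const; apply: eq_bigr => y /finset.setIdP[yT /andP[yn fy]].
rewrite sum1_card.
(* The fibre over y is the coset of y, reached by multiplication. *)
pose shift (z : {ffun 'I_d -> F}) : {ffun 'I_d -> F} := [ffun l => y l * z l].
have /torusP y0 := yT.
have shift_inj : injective shift.
  move=> z z' /ffunP H; apply/ffunP => l; have := H l; rewrite !ffunE.
  exact: mulfI.
rewrite -[RHS](card_imset _ shift_inj); apply: eq_card => x.
have nshift z l : monom (shift z) (col l (E K)) = monom y (col l (E K)) * monom z (col l (E K)).
  by rewrite -monomM; apply: monom_ext => k; rewrite ffunE.
rewrite unfold_in /=. apply/andP/imsetP => [[/finset.setIdP[xT fx] /eqP nx]|[z]].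
  have /torusP x0 := xT.
  pose z : {ffun 'I_d -> F} := [ffun l => x l / y l].
  have xz : x = shift z by apply/ffunP => l; rewrite !ffunE mulrCA mulfV ?mulr1.
  exists z => //; apply/finset.setIdP; split.
    by apply/torusP => l; rewrite ffunE mulf_neq0 ?invr_eq0.
  apply/forallP => l; apply/eqP; apply: (mulfI (y0 l)); rewrite mulr1.
  have := nshift z l; rewrite -xz => E1.
  have yl : y l = monom y (col l (E K)) by apply/eqP; have /forallP := yn.
  by rewrite yl -E1 -yl -nx ffunE.
move=> /finset.setIdP[/torusP z0 /forallP zK] ->.
have xT : shift z \in torus F d by apply/torusP => l; rewrite ffunE mulf_neq0.
have nx : norm (shift z) = y.
  apply/ffunP => l; rewrite ffunE nshift (eqP (zK l)) mulr1.
  by apply/esym/eqP; have /forallP := yn.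
rewrite nx eqxx; split=> //; apply/finset.setIdP; split=> //.
by rewrite -face_part_norm // nx.
Qed.

End FibreCount.

(** * The simplex of a Gale dual with one negative entry *)

Section GaleSimplex.
Variable d : nat.
Variables (m : 'M[int]_(d, d.+2)) (gamma : 'I_d.+2 -> int) (o : 'I_d.+2).
Variables (fb : 'M[int]_(d, d.+2)) (c H : 'M[int]_d) (b : 'cV[int]_d).
Hypothesis galeP : gale_dual m gamma.
Hypothesis kerP : kernel_basis gamma fb.
Hypothesis mE : m = c *m fb + (\matrix_(i < d, j < d.+2) b i 0).
Hypothesis hermP : hermite_form_of c H.
Hypothesis gamma_o : gamma o < 0.
Hypothesis gamma_pos : forall j, j != o -> 0 < gamma j.

Lemma hermite_det_neq0 : \det c != 0.
Proof.
case: hermP => -[Htri Hpos _] [A [_ HE]].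
have : \det H^T != 0.
  rewrite det_trig; last by apply/is_trig_mxP => i j ij; rewrite mxE Htri.
  by apply/prodf_neq0 => i _; rewrite mxE gt_eqF.
rewrite det_tr HE det_mulmx mulf_eq0 negb_or => /andP[_]; exact.
Qed.

(** The rows of fb together with the all-ones row are independent, and c is
    nonsingular because its Hermite form has positive diagonal entries. *)
Lemma affine_independent (a : int) (v : 'rV[int]_d) :
  (forall j, a + (v *m m) 0 j = 0) -> a = 0 /\ v = 0.
Proof.
move=> av.
have mj j : (v *m m) 0 j = ((v *m c) *m fb) 0 j + (v *m b) 0 0.
  rewrite mE mulmxDr mulmxA mxE; congr (_ + _).
  by rewrite !mxE; apply: eq_bigr => l _; rewrite mxE.
have : const_mx (a + (v *m b) 0 0) + (v *m c) *m fb = 0.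
  apply/rowP => j; rewrite mxE [const_mx _ _ _]mxE [RHS]mxE -(av j) mj.
  by rewrite -addrA; congr (_ + _); rewrite addrC.
move=> /(kerP.2) [a0 vc].
have v0 : v = 0.
  have : (v *m c) *m \adj c = 0 by rewrite vc mul0mx.
  rewrite -mulmxA mul_mx_adj mul_mx_scalar => /eqP.
  by rewrite scalemx_eq0 (negbTE hermite_det_neq0) => /eqP.
by split=> //; have := av o; rewrite v0 mul0mx mxE addr0.
Qed.

Let vert : 'M[int]_(d, d.+1) := \matrix_(l, j) m l (lift o j).
Let W : 'M[int]_(1 + d, d.+1) := col_mx (const_mx 1) vert.

Let Wsq : 'M[int]_(d.+1) := W.

(** An affine relation that holds at all m_j with j <> o holds at m_o as well,
    because gamma expresses m_o through them. *)
Lemma simplex_det_neq0 : \det Wsq != 0.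
Proof.
apply/det0P => -[v v0 vW]; move/eqP: v0; apply.
have vE : v = row_mx (lsubmx (v : 'rV_(1 + d))) (rsubmx (v : 'rV_(1 + d))) by rewrite hsubmxK.
set v1 := lsubmx _ in vE; set v2 := rsubmx _ in vE.
have vWE : v *m Wsq = v1 *m const_mx 1 + v2 *m vert.
  by rewrite {1}vE; exact: (mul_row_col v1 v2 (const_mx 1) vert).
pose y j := v1 0 0 + (v2 *m m) 0 j.
have yV j : j != o -> y j = 0.
  move=> jo; have [k ->] : exists k, j = lift o k.
    by case: (unliftP o j) => [k ->|E]; [exists k|rewrite E eqxx in jo].
  have := congr1 (fun M : 'rV[int]_(d.+1) => M 0 k) vW; rewrite [RHS]mxE vWE mxE => <-.
  congr (_ + _); first by rewrite [RHS]mxE big_ord_recl big_ord0 [const_mx _ _ _]mxE mulr1 addr0.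
  by rewrite mxE [RHS]mxE; apply: eq_bigr => l _; rewrite [vert _ _]mxE.
have sumy : \sum_j y j * gamma j = 0.
  case: galeP => g0 gm _; rewrite /y; under eq_bigr do rewrite mulrDl.
  rewrite big_split /= -mulr_sumr g0 mulr0 add0r.
  under eq_bigr do rewrite mxE mulr_suml.
  rewrite exchange_big big1 // => l _; under eq_bigr do rewrite -mulrA.
  by rewrite -mulr_sumr gm mulr0.
have yo : y o = 0.
  move: sumy; rewrite (bigD1 o) //= big1 ?addr0 => [|j jo]; last by rewrite yV // mul0r.
  by move/eqP; rewrite mulf_eq0 (lt_eqF gamma_o) orbF => /eqP.
have [v10 v20] : v1 0 0 = 0 /\ v2 = 0.
  by apply: affine_independent => j; have [->|/yV //] := eqVneq j o; exact: yo.
rewrite vE v20; have -> : v1 = 0 by apply/rowP => i; rewrite ord1 v10 mxE.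
by rewrite row_mx0.
Qed.

(** The barycentric functions are read off the adjugate of the matrix of the
    homogeneous coordinates of the vertices; multiplying by the determinant D
    makes the scale D^2 positive. At m_o they are positive because gamma_o is
    the only negative entry of the relation. *)
Lemma gale_simplex : exists T : lattice_simplex d,
  (forall j, vtx T j = col (lift o j) m) /\ (forall i, 0 < aff T (col o m) i).
Proof.
pose D := \det Wsq.
pose M : 'M[int]_(d.+1, 1 + d) := D *: \adj Wsq.
have MW : M *m Wsq = (D * D)%:M by rewrite -scalemxAl mul_adj_mx scale_scalar_mx.
have WM : Wsq *m M = (D * D)%:M by rewrite -scalemxAr mul_mx_adj scale_scalar_mx.
have D2 : ((`|D| * `|D|)%N : int) = D * D by rewrite PoszM -normrM ger0_norm // -expr2 sqr_ge0.
have sgt0 : (0 < `|D| * `|D|)%N by rewrite muln_gt0 absz_gt0 simplex_det_neq0.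
have ME : M = row_mx (lsubmx M) (rsubmx M) by rewrite hsubmxK.
have MWE : M *m Wsq = lsubmx M *m const_mx 1 + rsubmx M *m vert.
  by rewrite {1}ME; exact: (mul_row_col (lsubmx M) (rsubmx M) (const_mx 1) vert).
have WME : (Wsq *m M : 'M[int]_(1 + d, 1 + d)) =
    block_mx (const_mx 1 *m lsubmx M : 'M[int]_(1, 1)) (const_mx 1 *m rsubmx M : 'M[int]_(1, d))
      (vert *m lsubmx M) (vert *m rsubmx M).
  by rewrite {1}ME; exact: (mul_col_row (const_mx 1) vert (lsubmx M) (rsubmx M)).
have bv i j : (rsubmx M *m vert) i j + lsubmx M i 0 = ((`|D| * `|D|)%N%:Z) *+ (i == j).
  rewrite D2; have := congr1 (fun X : 'M[int]_(d.+1) => X i j) MW.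
  rewrite MWE [RHS]mxE => <-; rewrite [RHS]mxE [RHS]addrC; congr (_ + _).
  by rewrite [RHS]mxE big_ord_recl big_ord0 [const_mx _ _ _]mxE mulr1 addr0.
have := etrans (esym WME) WM; rewrite (scalar_mx_block 1 d) => /eq_block_mx [_ ur _ dr].
have bc (a : 'cV[int]_d) : \sum_i (rsubmx M *m a) i 0 = 0.
  have : (const_mx 1 *m (rsubmx M *m a) : 'M[int]_1) 0 0 = 0 by rewrite mulmxA ur mul0mx mxE.
  by rewrite mxE; under eq_bigr do rewrite mxE mul1r.
have vb : vert *m rsubmx M = ((`|D| * `|D|)%N%:Z)%:M by rewrite D2.
pose T := LatticeSimplex sgt0 bv bc vb.
have vE j : vtx T j = col (lift o j) m by apply/colP => l; rewrite !mxE.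
exists T; split=> // i.
have : \sum_j gamma j * aff T (col j m) i = 0.
  case: galeP => g0 gm _; rewrite /aff; under eq_bigr do rewrite mulrDr.
  rewrite big_split /= -mulr_suml g0 mul0r addr0.
  transitivity (lin T (\sum_j gamma j *: col j m) i).
    by rewrite lin_sumr; apply: eq_bigr => j _; rewrite linZ.
  rewrite (_ : \sum_j _ = 0) ?lin0 //; apply/colP => l; rewrite summxE [RHS]mxE -[RHS](gm l).
  by apply: eq_bigr => j _; rewrite !mxE mulrC.
rewrite (bigD1 o) //= => /eqP; rewrite addr_eq0 => /eqP E.
have : 0 < \sum_(j | j != o) gamma j * aff T (col j m) i.
  rewrite (bigD1 (lift o i)) ?(eq_sym _ o) ?neq_lift //= ltr_pwDl //.
    rewrite -vE aff_vtx eqxx mulr_gt0 ?gamma_pos ?(eq_sym _ o) ?neq_lift //.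
  apply: sumr_ge0 => j /andP[jo _]; apply: mulr_ge0; first exact/ltW/gamma_pos.
  case: (unliftP o j) => [k ->|jE]; last by rewrite jE eqxx in jo.
  by rewrite -vE aff_vtx; case: eqP.
rewrite -oppr_lt0 -E nmulr_rlt0 //.
Qed.

End GaleSimplex.

(** * Summation over the faces *)

Lemma sum_set_prod (C : comNzRingType) (I : finType) (a b : I -> C) :
  \prod_i (a i + b i) = \sum_(K : {set I}) \prod_i (if i \in K then a i else b i).
Proof. by rewrite bigA_distr; apply: eq_bigl => K; rewrite inE. Qed.

Section SumOverFaces.
Variables (C : fieldType) (d : nat) (n : C) (o : 'I_d.+2) (A : {set 'I_d.+1} -> {set 'I_d.+2}).
Variables (G : 'I_d.+2 -> C) (z : pred 'I_d.+2).
Hypothesis n0 : n != 0.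
Hypothesis A_lift : forall K k, (lift o k \in A K) = (k \in K).
Hypothesis A_o : forall K, (o \in A K) = (K == [set: 'I_d.+1]%SET).
Hypothesis G_trivial : forall j, z j -> G j = -1.

Let term (K : {set 'I_d.+1}) : C :=
  (z o)%:R * \prod_k (if k \in K then G (lift o k) else (z (lift o k))%:R).

(** In the application n = q - 1, and A K is the set of exponents on the face K,
    so the interior one is in A K only for the whole simplex. For the other K
    the summand is term K. Summed over all K, the terms give the product over
    the vertices of G + [z], whose factors with z true vanish because G = -1.
    What remains is the difference between the summand and term for the whole
    simplex, and the missing empty K. *)
Lemma sum_over_faces :
  \sum_(K : {set 'I_d.+1} | K != finset.set0)
     n ^+ #|K| * \prod_j (if j \in A K then n^-1 * G j else (z j)%:R)
  = n^-1 * (\prod_j G j) * (n + 1) ^+ (z o && [exists k, z (lift o k)])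
    - ([forall j, z j])%:R.
Proof.
have prodD (h : 'I_d.+2 -> C) : \prod_j h j = h o * \prod_k h (lift o k).
  by rewrite (bigD1_ord o).
have lower K : K != [set: 'I_d.+1]%SET ->
    n ^+ #|K| * \prod_j (if j \in A K then n^-1 * G j else (z j)%:R) = term K.
  move=> KT; rewrite prodD A_o (negbTE KT) /term mulrCA; congr (_ * _).
  rewrite -prodr_const [X in X * _]big_mkcond /= -big_split; apply: eq_bigr => k _ /=.
  by rewrite A_lift; case: ifP => _; rewrite ?mul1r // mulVKf.
have full : n ^+ #|[set: 'I_d.+1]%SET| *
      \prod_j (if j \in A [set: 'I_d.+1]%SET then n^-1 * G j else (z j)%:R)
    = n^-1 * \prod_j G j.
  rewrite [in RHS]prodD prodD A_o eqxx cardsT card_ord.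
  rewrite (eq_bigr (fun k => n^-1 * G (lift o k))) => [|k _]; last by rewrite A_lift inE.
  rewrite big_split /= prodr_const card_ord exprVn.
  by field; rewrite expf_neq0 ?n0.
have termT : term [set: 'I_d.+1]%SET = - (z o)%:R * \prod_j G j.
  rewrite /term prodD (eq_bigr (fun k => G (lift o k))) => [|k _]; last by rewrite inE.
  by case: (boolP (z o)) => [/G_trivial ->|_]; rewrite ?mulr1n ?mulr0n; ring.
have term0 : term finset.set0 = ([forall j, z j])%:R.
  rewrite /term (eq_bigr (fun k => (z (lift o k))%:R)) => [|k _]; last by rewrite inE.
  rewrite -(prodD (fun j => (z j)%:R)); case: forallP => [H|/forallP].
    by rewrite big1 // => j _; rewrite H.
  by rewrite negb_forall => /existsP[j /negbTE jz]; rewrite (bigD1 j) //= jz mul0r.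
have termS : \sum_K term K = - (z o)%:R * (\prod_j G j) * (~~ [exists k, z (lift o k)])%:R.
  rewrite /term -mulr_sumr -sum_set_prod.
  case: existsP => [[k zk]|N].
    by rewrite (bigD1 k) //= (G_trivial zk) zk addNr mul0r !mulr0.
  rewrite (eq_bigr (fun k => G (lift o k))) => [|k _].
    rewrite prodD; case: (boolP (z o)) => [/G_trivial ->|_]; rewrite ?mulr1n ?mulr0n; ring.
  by case: (boolP (z (lift o k))) => [zk|_]; rewrite ?addr0 //; case: N; exists k.
have T0 : [set: 'I_d.+1]%SET != finset.set0.
  by apply/finset.set0Pn; exists ord0; rewrite inE.
rewrite (bigD1 [set: 'I_d.+1]%SET) //= full.
rewrite (eq_bigr term) => [|K /andP[_]]; last exact: lower.
have -> : \sum_(K | (K != finset.set0) && (K != [set: 'I_d.+1]%SET)) term K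
     = \sum_K term K - term finset.set0 - term [set: 'I_d.+1]%SET.
  rewrite [in RHS](bigD1 finset.set0) //= [in RHS](bigD1 [set: 'I_d.+1]%SET) //=.
  ring.
rewrite termS termT term0.
case: (z o); case: [exists k, _]; rewrite /= ?mulr1n ?mulr0n ?expr0 ?expr1; field; exact: n0.
Qed.

End SumOverFaces.

Lemma sum_pow_card (C : comNzRingType) (I : finType) (n : C) :
  \sum_(K : {set I}) n ^+ #|K| = (n + 1) ^+ #|I|.
Proof.
rewrite -[in RHS]cardsT -prodr_const.
rewrite (eq_bigl predT) => [|k]; last by rewrite inE.
rewrite (sum_set_prod (fun=> n) (fun=> 1)); apply: eq_bigr => K _.
by rewrite -prodr_const [LHS]big_mkcond.
Qed.

Section LaurentOf.
Variables (F : fieldType) (d N : nat) (m : 'M[int]_(d, N)) (u : 'I_N -> F).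
Hypothesis u0 : forall j, u j != 0.
Hypothesis m_inj : injective (fun j => col j m).

Lemma laurent_ofE j : laurent_of m u (col j m) = u j.
Proof.
rewrite fsfunE; have -> : col j m \in [fset col j0 m | j0 in 'I_N]%fset by apply/imfsetP; exists j.
by rewrite (big_pred1 j) // => i; apply/eqP/eqP => [/m_inj|->].
Qed.

Lemma finsupp_laurent_of : finsupp (laurent_of m u) = [fset col j m | j in 'I_N]%fset.
Proof.
apply/fsetP => e; rewrite mem_finsupp; apply/idP/imfsetP => [|[j _ ->]];
  last by rewrite laurent_ofE.
by rewrite fsfunE; case: ifP => [/imfsetP|]; rewrite ?eqxx.
Qed.

Lemma sum_laurent_of (Q : pred 'cV[int]_d) (g : 'cV[int]_d -> F) :
  \sum_(e <- finsupp (laurent_of m u) | Q e) laurent_of m u e * g e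
    = \sum_(j | Q (col j m)) u j * g (col j m).
Proof.
rewrite big_mkcond finsupp_laurent_of big_imfset /=; last by move=> i j _ _; apply: m_inj.
rewrite [RHS]big_mkcond big_enum /=; apply: eq_bigr => j _.
by rewrite laurent_ofE.
Qed.

End LaurentOf.

(** * The hypergeometric side *)

(** The characteristic p of F divides its cardinality, by Lagrange for the additive
    group. *)
Lemma intr_neq0_coprime (F : finFieldType) (a : int) : coprime #|F| `|a| -> a%:~R != 0 :> F.
Proof.
move=> cop; have [p pr pF] := finPcharP F.
apply/negP; rewrite -(dvdz_pcharf pF) dvdzE /= => pa.
have pq : (p %| #|F|)%N.
  rewrite (dvdn_pcharf pF); apply/eqP.
  by rewrite -FinRing.zmodXgE -cardsT; apply: (expg_cardG (G := [set: F]%G)); rewrite inE.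
have : (p %| gcdn #|F| `|a|)%N by rewrite dvdn_gcd pq pa.
by move: cop; rewrite /coprime => /eqP ->; rewrite dvdn1 => /eqP p1; rewrite p1 in pr.
Qed.

Lemma cancel_multiplicity (C : fieldType) (Q g : C) (P g1 X : C) (s0 s1 : nat) :
  Q != 0 -> g != 0 ->
  P * Q ^ (s0%:Z - 1) * g * (g1 / g * Q ^ (s1%:Z - s0%:Z) * X) = Q^-1 * (P * X * g1 * Q ^+ s1).
Proof.
move=> Q0 g0; have -> : Q ^+ s1 = Q ^ (s0%:Z - 1) * Q ^ (s1%:Z - s0%:Z) * Q.
  rewrite -(expfzDr _ _ Q0) -[RHS](expfzDr _ 1 Q0) exprnP.
  by congr (Q ^ _); ring.
by field; rewrite g0 Q0.
Qed.

Section HypergeometricSide.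
Variables (R : realType) (F : finFieldType) (d : nat) (psi chi : F -> R[i]).
Variables (m : 'M[int]_(d, d.+2)) (u : 'I_d.+2 -> F) (gamma : 'I_d.+2 -> int).
Variables (fb rho : 'M[int]_(d, d.+2)) (c H : 'M[int]_d) (b : 'cV[int]_d) (o : 'I_d.+2).
Hypothesis psiA : additive_character psi.
Hypothesis psi_nontrivial : exists x, psi x != 1.
Hypothesis chiM : multiplicative_character chi.
Hypothesis chi_ord : character_order chi #|F|.-1.
Hypothesis u0 : forall j, u j != 0.
Hypothesis galeP : gale_dual m gamma.
Hypothesis kerP : kernel_basis gamma fb.
Hypothesis mE : m = c *m fb + (\matrix_(i < d, j < d.+2) b i 0).
Hypothesis hermP : hermite_form_of c H.
Hypothesis dualP : dual_system fb rho.
Hypothesis gamma_unit : coprime #|F| `|(\prod_(j < d.+2) gamma j)%R|%N.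
Hypothesis gneg : forall j, (gamma j < 0) = (j == o).
Hypothesis gpos : forall j, (0 < gamma j) = (j != o).

Local Notation q := (#|F|).
Local Notation n := (#|F|.-1).
Let n_gt0 := card_units_gt0 F.

(** For the vector of parameters (lambda, k), this is the multiplicity of
    zeta^(- k) as a root of D_delta. *)
Definition common_root (mu : {ffun 'I_d.+2 -> 'I_n}) : bool :=
  ((mu o : nat) == 0%N) && [exists k, (mu (lift o k) : nat) == 0%N].

Let t : F := \prod_(j < d.+2) u j ^ gamma j.
Let sigma (k : 'I_d) : F := \prod_(j < d.+2) u j ^ rho k j.

Let gamma_gamma_neq0 : gamma_gamma F gamma != 0.
Proof.
apply/prodf_neq0 => j _; apply/expfz_neq0/intr_neq0_coprime.
by apply: coprime_dvdr gamma_unit; rewrite (bigD1 j) //= abszM dvdn_mulr.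
Qed.

Let residue_eq0 k : ((residue n_gt0 k : nat) == 0%N) = (n %| k)%Z.
Proof. by rewrite -(eqz_nat _ 0) residueE //; apply/eqP/dvdz_mod0P. Qed.

Let twisted_gauss_residue j (v : int) :
  twisted_gauss psi chi u j (residue n_gt0 v) = gauss psi chi v * chi (u j) ^ (- v).
Proof.
rewrite /twisted_gauss residueE // (gauss_modz psi chiM chi_ord); congr (_ * _).
by rewrite -!invr_expz (char_pow_modn chiM chi_ord).
Qed.

(** As sigma and t are the monomials in u with exponents rho and gamma, the
    characters of sigma and t collect to prod_j chi(u_j)^(- mu_j) with
    mu = - gamma k + sum_l lambda_l rho_l. *)
Lemma hypergeometric_term (lam : {ffun 'I_d -> 'I_n}) (k : 'I_n) :
  (\prod_(l < d) chi (sigma l) ^ (- (lam l)%:Z)) * chi t ^+ k *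
    gauss_vec psi chi (fun j => - gamma j * (k : nat)%:Z + delta_of rho lam j) *
    q%:R ^+ (s_mult R F gamma (delta_of rho lam) (- (k : nat)%:Z))
  = (\prod_j twisted_gauss psi chi u j (param_char n_gt0 gamma rho (lam, k) j)) *
      q%:R ^+ common_root (param_char n_gt0 gamma rho (lam, k)).
Proof.
pose v j := - gamma j * (k : nat)%:Z + delta_of rho lam j.
have relE j : param_char n_gt0 gamma rho (lam, k) j = residue n_gt0 (v j).
  by rewrite ffunE mxE.
congr (_ * _); last first.
  rewrite (s_mult_one_negative R F _ _ gneg gpos); congr (_ ^+ nat_of_bool _).
  rewrite /common_root relE residue_eq0; congr (_ && _).
  apply/existsP/existsP => -[j].
    case: (unliftP o j) => [l ->|->]; last by rewrite eqxx.
    by move=> /andP[_ H1]; exists l; rewrite relE residue_eq0.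
  rewrite relE residue_eq0 => H1; exists (lift o j).
  by rewrite eq_sym neq_lift H1.
transitivity (\prod_j (chi (u j) ^ (- v j)) * gauss_vec psi chi v).
  congr (_ * _).
  have -> : chi t ^+ k = \prod_j chi (u j) ^ (gamma j * (k : nat)%:Z).
    rewrite /t (char_prod chiM) => [|j]; last exact: expfz_neq0.
    rewrite -prodrXl; apply: eq_bigr => j _.
    by rewrite (charXz chiM) // -exprz_exp.
  have -> : \prod_(l < d) chi (sigma l) ^ (- (lam l)%:Z) =
      \prod_j chi (u j) ^ (- delta_of rho lam j).
    transitivity (\prod_(l < d) \prod_(j < d.+2) chi (u j) ^ (rho l j * - (lam l)%:Z)).
      apply: eq_bigr => l _; rewrite /sigma (char_prod chiM) => [|j]; last exact: expfz_neq0.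
      rewrite (big_morph (fun a : R[i] => a ^ (- (lam l)%:Z))
        (fun a b => expfzMl a b _) (exp1rz _ _)).
      by apply: eq_bigr => j _; rewrite (charXz chiM) // exprz_exp.
    rewrite exchange_big; apply: eq_bigr => j _; rewrite prod_expfz ?(char_neq0 chiM) //.
    congr (_ ^ _); rewrite -sumrN; apply: eq_bigr => l _; ring.
  rewrite -big_split; apply: eq_bigr => j _ /=; rewrite -expfzDr ?(char_neq0 chiM) //.
  by congr (_ ^ _); rewrite /v; ring.
rewrite -big_split; apply: eq_bigr => j _ /=.
by rewrite relE twisted_gauss_residue mulrC.
Qed.

Lemma hypergeometric_side :
  \sum_(lam : {ffun 'I_d -> 'I_n} | Lambda H^T lam)
     (\prod_(k < d) chi (sigma k) ^ (- (lam k)%:Z)) *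
     q%:R ^ ((s_mult R F gamma (delta_of rho lam) 0)%:Z - 1) *
     gauss_vec psi chi (delta_of rho lam) *
     hypergeometric_sum psi chi gamma (delta_of rho lam) (t / gamma_gamma F gamma)
  = (1 - q%:R)^-1 * q%:R^-1 *
     \sum_(mu in relation_chars n m)
        (\prod_j twisted_gauss psi chi u j (mu j)) * q%:R ^+ common_root mu.
Proof.
have q0 : q%:R != 0 :> R[i] := natq_neq0 R F.
have [h' hK Hh] := relation_chars_param n_gt0 galeP kerP mE hermP dualP.
rewrite (reindex_onto (param_char n_gt0 gamma rho) h') //=.
rewrite (eq_bigl _ _ Hh).
pose G (p : {ffun 'I_d -> 'I_n} * 'I_n) :=
  (\prod_j twisted_gauss psi chi u j (param_char n_gt0 gamma rho p j)) *
     q%:R ^+ common_root (param_char n_gt0 gamma rho p).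
rewrite -[X in _ = _ * X]/(\sum_(p | Lambda H^T p.1) G p).
have -> : \sum_(p | Lambda H^T p.1) G p = \sum_(lam | Lambda H^T lam) \sum_k G (lam, k).
  by rewrite pair_big_dep /=; apply: eq_big => [[lam k]|[lam k] _]; rewrite ?andbT.
rewrite /G {G}.
rewrite mulr_sumr; apply: eq_bigr => lam _.
rewrite /hypergeometric_sum mulrCA -[RHS]mulrA; congr (_ * _).
rewrite !mulr_sumr; apply: eq_bigr => k _; rewrite -hypergeometric_term.
have -> : gamma_gamma F gamma * (t / gamma_gamma F gamma) = t by rewrite mulrC mulfVK.
have g0 : gauss_vec psi chi (delta_of rho lam) != 0.
  by apply/prodf_neq0 => j _; apply: gauss_neq0.
exact: cancel_multiplicity.
Qed.

End HypergeometricSide.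

(** * The count *)

Section CountClosure.
Local Open Scope classical_set_scope.
Local Open Scope ring_scope.
Variables (R : realType) (F : finFieldType) (d : nat) (psi chi : F -> R[i]).
Variables (m : 'M[int]_(d, d.+2)) (u : 'I_d.+2 -> F) (o : 'I_d.+2) (T : lattice_simplex d).
Hypothesis psiA : additive_character psi.
Hypothesis psi_nontrivial : exists x, psi x != 1.
Hypothesis chiM : multiplicative_character chi.
Hypothesis chi_ord : character_order chi #|F|.-1.
Hypothesis u0 : forall j, u j != 0.
Hypothesis m_inj : injective (fun j => col j m).
Hypothesis T_vertices : forall j, vtx T j = col (lift o j) m.
Hypothesis T_interior : forall i, 0 < aff T (col o m) i.

Local Notation q := (#|F|).
Local Notation n := (#|F|.-1).
Local Notation f := (laurent_of m u).

Lemma simplex_vertex_supp j : vtx T j \in finsupp f.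
Proof. by rewrite T_vertices finsupp_laurent_of //; apply/imfsetP; exists (lift o j). Qed.

Lemma simplex_supp e : e \in finsupp f -> forall i, 0 <= aff T e i.
Proof.
rewrite finsupp_laurent_of // => /imfsetP[j _ ->] i.
case: (unliftP o j) => [k ->|->]; last exact: ltW.
by rewrite -T_vertices aff_vtx; case: (i == k); rewrite ?mulr1n ?mulr0n.
Qed.

Definition face_monomials (K : {set 'I_d.+1}) : {set 'I_d.+2} :=
  [set j : 'I_d.+2 | [forall i, (i \notin K) ==> (aff T (col j m) i == 0)]]%SET.

Lemma face_monomials_lift K k : (lift o k \in face_monomials K) = (k \in K).
Proof.
rewrite inE; apply/forallP/idP => [/(_ k)|kK i].
  rewrite -T_vertices aff_vtx eqxx; case: (k \in K) => //=.
  by have := scale_gt0 T; rewrite mulr1n; lia.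
apply/implyP => iK; rewrite -T_vertices aff_vtx.
by have -> : (i == k) = false by apply: contraNF iK => /eqP ->.
Qed.

Lemma face_monomials_interior K : (o \in face_monomials K) = (K == [set: 'I_d.+1]%SET).
Proof.
rewrite inE; apply/forallP/eqP => [H|-> i]; last by rewrite inE.
apply/setP => i; rewrite inE; apply: contraT => iK; have := H i.
by rewrite iK /= gt_eqF.
Qed.

Lemma face_partE K x : face_part T f K x = \sum_(j in face_monomials K) u j * monom x (col j m).
Proof.
rewrite /face_part (sum_laurent_of u0 m_inj) //.
by apply: eq_bigl => j; rewrite inE.
Qed.

Variable E : {set 'I_d.+1} -> 'M[int]_d.
Hypothesis EP : forall K, K != finset.set0 ->
  [/\ forall a, face_lattice T K (E K *m a),
      forall a, face_lattice T K a -> E K *m a = a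
    & #|trivial_on F (E K)| = (n ^ (d.+1 - #|K|))%N ].

Let G (mu : {ffun 'I_d.+2 -> 'I_n}) : R[i] := \prod_j twisted_gauss psi chi u j (mu j).

(** Both the number of lifts and the character sum contribute powers of q - 1;
    multiplied by q (q-1), the count involves only the powers (q-1)^|K|, whose
    sum over K is explicit. *)
Lemma count_orbit K : K != finset.set0 ->
  q%:R * n%:R * #|orbit_points T f E K|%:R
   = n%:R ^+ #|K| + n%:R * \sum_(mu in relation_chars n m)
        (n%:R ^+ #|K| * \prod_j local_coef psi chi u (face_monomials K) j (mu j)) :> R[i].
Proof.
move=> K0; have [E1 E2 E3] := EP K0; have n0 := natn_neq0 R F.
have Kd : (#|K| <= d.+1)%N by rewrite -[X in (_ <= X)%N]card_ord max_card.
apply: (mulIf (expf_neq0 (d.+1 - #|K|) n0)).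
have := count_hypersurface psiA psi_nontrivial chiM chi_ord m u0 (face_monomials K).
have -> : #|[set x in torus F d | \sum_(j in face_monomials K) u j * monom x (col j m) == 0]%SET|
    = (#|orbit_points T f E K| * n ^ (d.+1 - #|K|))%N.
  rewrite -E3 -(card_face_solutions f K0 E1 E2).
  by apply: eq_card => x; rewrite !inE face_partE.
rewrite natrM natrX => H.
have -> : q%:R * n%:R * #|orbit_points T f E K|%:R * n%:R ^+ (d.+1 - #|K|) =
   n%:R * (q%:R * (#|orbit_points T f E K|%:R * n%:R ^+ (d.+1 - #|K|))) :> R[i] by ring.
rewrite H mulrDr -exprS mulrDl -exprD subnKC //; congr (_ + _).
rewrite -mulr_sumr.
transitivity (n%:R * (n%:R ^+ #|K| * n%:R ^+ (d.+1 - #|K|)) *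
  \sum_(mu in relation_chars n m) \prod_j local_coef psi chi u (face_monomials K) j (mu j) : R[i]).
  by rewrite -exprD subnKC // mulrA.
by ring.
Qed.

(** The sum of (q-1)^|K| over K nonempty is q^(d+1) - 1, and the missing empty
    face contributes 1 for the zero vector mu0 alone, that is, q - 1 after
    scaling. *)
Lemma count_closure_scaled :
  q%:R * n%:R * (\sum_(K : {set 'I_d.+1} | K != finset.set0) #|orbit_points T f E K|)%:R
  = q%:R ^+ d.+1 - q%:R +
    \sum_(mu in relation_chars n m) G mu * q%:R ^+ common_root o mu :> R[i].
Proof.
have n0 := natn_neq0 R F.
have qE : q%:R = n%:R + 1 :> R[i].
  by rewrite natr1 prednK // (ltn_trans _ (finNzRing_gt1 F)).
have n_gt0 := card_units_gt0 F.
rewrite natr_sum mulr_sumr.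
rewrite (eq_bigr _ (fun K K0 => count_orbit K0)) big_split /= -mulr_sumr exchange_big /=.
have -> : \sum_(K : {set 'I_d.+1} | K != finset.set0) n%:R ^+ #|K| = q%:R ^+ d.+1 - 1 :> R[i].
  have := @sum_pow_card R[i] 'I_d.+1 n%:R; rewrite card_ord -qE => <-.
  by rewrite [in RHS](bigD1 finset.set0) //= cards0 expr0 addrC addrK.
pose mu0 : {ffun 'I_d.+2 -> 'I_n} := [ffun=> Ordinal n_gt0].
have mu0_in : mu0 \in relation_chars n m.
  rewrite inE; apply/andP; split.
    by rewrite big1 ?dvdz0 // => j _; rewrite ffunE.
  by apply/forallP => i; rewrite big1 ?dvdz0 // => j _; rewrite ffunE mulr0.
have -> : \sum_(mu in relation_chars n m) \sum_(K : {set 'I_d.+1} | K != finset.set0)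
     n%:R ^+ #|K| * \prod_j local_coef psi chi u (face_monomials K) j (mu j)
   = n%:R^-1 * (\sum_(mu in relation_chars n m) G mu * q%:R ^+ common_root o mu) - 1 :> R[i].
  transitivity (\sum_(mu in relation_chars n m) (n%:R^-1 * (G mu * q%:R ^+ common_root o mu)
     - (mu == mu0)%:R) : R[i]).
    apply: eq_bigr => mu _.
    rewrite /local_coef (sum_over_faces (n := n%:R) (o := o) (A := face_monomials)
      (G := fun j => twisted_gauss psi chi u j (mu j)) (z := fun j => (mu j : nat) == 0%N)) //.
    - rewrite qE -mulrA; congr (_ - _%:R); congr nat_of_bool.
      apply/forallP/eqP => [H|-> j]; last by rewrite ffunE.
      by apply/ffunP => j; rewrite ffunE; apply: val_inj; apply/eqP/H.
    - exact: face_monomials_lift.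
    - exact: face_monomials_interior.
    move=> j /eqP ->; rewrite /twisted_gauss oppr0 expr0z mulr1.
    exact: (gauss_trivial psiA psi_nontrivial chiM chi_ord (dvdz0 _)).
  rewrite sumrB -mulr_sumr; congr (_ - _).
  rewrite (bigD1 mu0) //= eqxx big1 ?addr0 // => mu /andP[_ /negbTE ->] //.
by rewrite qE; field; exact: n0.
Qed.

End CountClosure.
Local Open Scope classical_set_scope.
Local Open Scope ring_scope.

Theorem corollary1p5 (R : realType) (F : finFieldType) (d : nat)
    (psi chi : F -> R[i])
    (m : 'M[int]_(d, d.+2)) (u : 'I_d.+2 -> F) (gamma : 'I_d.+2 -> int)
    (fb : 'M[int]_(d, d.+2)) (c : 'M[int]_d) (b : 'cV[int]_d)
    (H : 'M[int]_d) (rho : 'M[int]_(d, d.+2)) :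
  let q := #|F| in
  let f := laurent_of m u in
  let Delta := newton_polytope R f in
  let N := H^T in
  let t := \prod_(j < d.+2) u j ^ gamma j in
  let sigma := fun k : 'I_d => \prod_(j < d.+2) u j ^ rho k j in
  additive_character psi -> (exists x, psi x != 1) ->
  multiplicative_character chi -> character_order chi q.-1 ->
  (forall j, u j != 0) ->
  injective (fun j => col j m) ->
  newton_dim R f = d ->
  gale_dual m gamma ->
  (forall j, gamma j != 0) ->
  kernel_basis gamma fb ->
  m = c *m fb + (\matrix_(i < d, j < d.+2) b i 0) ->
  hermite_form_of c H ->
  dual_system fb rho ->
  coprime q `|(\prod_(j < d.+2) gamma j)%R|%N ->
  #|[pred j | (gamma j < 0)%R]| = 1%N ->
  #|[pred j | (0 < gamma j)%R]| = d.+1 ->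
  exists2 n : nat,
    (closure_points (normal_fan Delta) (principal_ideal f) #= `I_n)%card &
    n%:R = (q%:R ^+ d - 1) / (q%:R - 1)
      - \sum_(lam : {ffun 'I_d -> 'I_q.-1} | Lambda N lam)
          (\prod_(k < d) chi (sigma k) ^ (- (lam k)%:Z)) *
          q%:R ^ ((s_mult R F gamma (delta_of rho lam) 0)%:Z - 1) *
          gauss_vec psi chi (delta_of rho lam) *
          hypergeometric_sum psi chi gamma (delta_of rho lam)
            (t / gamma_gamma F gamma)
      :> R[i].
Proof.
move=> q f Delta N t sigma psiA psiN chiM chi_ord u0 m_inj _ galeP gamma0 kerP mE.
move=> hermP dualP cop neg1 _.
case: (mem_card1 neg1) => o oP.
have gneg j : (gamma j < 0) = (j == o) by have := oP j; rewrite !inE.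
have gpos j : (0 < gamma j) = (j != o) by rewrite -gneg -leNgt lt_neqAle eq_sym gamma0.
have go : gamma o < 0 by rewrite gneg.
have gp j : j != o -> 0 < gamma j by rewrite gpos.
have [T [TV TI]] := gale_simplex galeP kerP mE hermP go gp.
have [E EP] := boolp.choice (face_projector T F).
have EP' K : K != finset.set0 ->
  (forall a, face_lattice T K (E K *m a)) /\ (forall a, face_lattice T K a -> E K *m a = a).
  by move=> /EP[].
exists (\sum_(K : {set 'I_d.+1} | K != finset.set0) #|orbit_points T f E K|)%N.
  apply: closure_points_card EP'.
    exact: (simplex_vertex_supp u0 m_inj TV).
  exact: (simplex_supp u0 m_inj TV TI).
rewrite (hypergeometric_side psiA psiN chiM chi_ord u0 galeP kerP mE hermP dualP cop gneg gpos).
have q0 : #|F|%:R != 0 :> R[i] := natq_neq0 R F.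
have n0 : #|F|.-1%:R != 0 :> R[i] := natn_neq0 R F.
have qE : #|F|%:R = #|F|.-1%:R + 1 :> R[i].
  by rewrite natr1 prednK // (ltn_trans _ (finNzRing_gt1 F)).
apply: (mulfI (mulf_neq0 q0 n0)).
rewrite (count_closure_scaled psiA psiN chiM chi_ord u0 m_inj TV TI EP) /q.
set S := \sum_(mu in _) _.
rewrite exprS.
have nE : #|F|.-1%:R = #|F|%:R - 1 :> R[i] by rewrite qE addrK.
rewrite nE in n0 *; field.
by rewrite q0 n0 /= -opprB oppr_eq0 n0.
Qed.
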